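(* Let $\alpha\in(0,1)$, $\nu,\gamma>0$, and $u_0>0$. Let $u\in W^{1,1}_{loc}([0,\infty))$ be the (nonnegative) solution of $$\partial_t^\alpha(u-u_0)+\nu u^\gamma=0,\quad t\ge0,\qquad u(0)=u_0 .$$ Define $$\mu=\nu\,\Gamma(1-\alpha)\Gamma(1+\alpha)u_0^\gamma,\qquad \varepsilon=\Big(\frac{u_0\Gamma(1+\alpha)}{2\mu}\Big)^{1/\alpha},$$ $$v(t)=\begin{cases}u_0-\mu\, g_{1+\alpha}(t), & t\in[0,\varepsilon],\\ \varepsilon^{\alpha/\gamma}\,\frac{u_0}{2}\,t^{-\alpha/\gamma}, & t\ge\varepsilon,\end{cases}$$ and define $t_0>0$ and $w$ by $$t_0^\alpha=\frac{u_0^{1-\gamma}}{\nu}\Big(g_{1-\alpha}\big(\tfrac12\big)+\frac{\alpha}{\gamma}\,\frac{2^{\alpha+\frac{\alpha}{\gamma}}}{\Gamma(2-\alpha)}\Big),\qquad w(t)=\begin{cases}u_0, & t\in[0,t_0],\\ u_0\,t_0^{\alpha/\gamma}\,t^{-\alpha/\gamma}, & t\ge t_0.\end{cases}$$ Then $v(t)\le u(t)\le w(t)$ for all $t\ge0$. In particular there exist constants $c_1,c_2>0$ such that $$\frac{c_1}{1+t^{\frac{\alpha}{\gamma}}}\le u(t)\le\frac{c_2}{1+t^{\frac{\alpha}{\gamma}}},\quad t\ge0 .$$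
   Context: $g_\beta(t)=t^{\beta-1}/\Gamma(\beta)$ for $t>0$, $\beta>0$ (with $g_{1+\alpha}(0)=0$); $(k\ast f)(t)=\int_0^tk(t-\tau)f(\tau)\,d\tau$; $\partial_t^\alpha f=\frac{d}{dt}(g_{1-\alpha}\ast f)$ is the Riemann–Liouville fractional derivative. The equation is understood to hold for a.a. $t>0$. *)

(* Defs.v *)
From HB Require Import structures.
From mathcomp Require Import all_boot all_order all_algebra.
From mathcomp Require Import all_classical all_reals all_analysis.
Set Implicit Arguments.
Unset Strict Implicit.
Unset Printing Implicit Defensive.
Import Order.TTheory GRing.Theory Num.Theory.
Import numFieldNormedType.Exports.
Local Open Scope classical_set_scope.
Local Open Scope ring_scope.

Definition Gamma {R : realType} (x : R) : R :=
  \int[@lebesgue_measure R]_(s in `]0, +oo[) (s `^ (x - 1) * expR (- s)).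

(* Only used for 0 <= t. At t = 0, powR gives 0 whenever beta <> 1; hence
   g_(1 + alpha)(0) = 0 for alpha > 0, and g_(1 - alpha)(0) = 0 is a harmless
   value at the singularity. *)
Definition g {R : realType} (beta t : R) : R := t `^ (beta - 1) / Gamma beta.

Definition conv {R : realType} (k f : R -> R) (t : R) : R :=
  \int[@lebesgue_measure R]_(s in `[0, t]) (k (t - s) * f s).

(* RLderive is total: it is meaningful only at points where RLderivable holds. *)
Definition RLderivable {R : realType} (alpha : R) (f : R -> R) (t : R) : Prop :=
  derivable (conv (g (1 - alpha)) f) t 1.

Definition RLderive {R : realType} (alpha : R) (f : R -> R) (t : R) : R :=
  derive1 (conv (g (1 - alpha)) f) t.

Definition L1loc_pos {R : realType} (f : R -> R) : Prop :=
  forall T : R, 0 < T ->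
    (@lebesgue_measure R).-integrable `[0, T] (EFin \o f).

(* C^1 functions with compact support contained in the open half-line. *)
Definition test_function {R : realType} (phi : R -> R) : Prop :=
  [/\ forall x, derivable phi x 1, continuous (derive1 phi) &
      exists a b : R, 0 < a /\ forall x, x \notin `[a, b] -> phi x = 0].

Definition weak_derivative_pos {R : realType} (f f' : R -> R) : Prop :=
  forall phi : R -> R, test_function phi ->
    \int[@lebesgue_measure R]_(x in `]0, +oo[) (f x * derive1 phi x) =
    - \int[@lebesgue_measure R]_(x in `]0, +oo[) (f' x * phi x).

(* W^{1,1}_loc([0, +oo)): local integrability is up to and including 0.
   Elements are classes modulo a.e. equality; their point values are those of
   the continuous representative, so continuity on [0, +oo) is part of the
   predicate on genuine functions. *)
Definition W11loc_pos {R : realType} (f : R -> R) : Prop :=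
  {within `[0, +oo[, continuous f} /\
  exists f' : R -> R,
    [/\ L1loc_pos f, L1loc_pos f' & weak_derivative_pos f f'].

Section barriers.
Context {R : realType}.
Variables alpha nu gamma u0 : R.

Definition mu : R := nu * Gamma (1 - alpha) * Gamma (1 + alpha) * u0 `^ gamma.

Definition eps : R := (u0 * Gamma (1 + alpha) / (2 * mu)) `^ (1 / alpha).

Definition v (t : R) : R :=
  if t <= eps then u0 - mu * g (1 + alpha) t
  else eps `^ (alpha / gamma) * (u0 / 2) * t `^ (- (alpha / gamma)).

Definition t0_pow_alpha : R :=
  u0 `^ (1 - gamma) / nu *
  (g (1 - alpha) (1 / 2) +
   alpha / gamma * (2 `^ (alpha + alpha / gamma) / Gamma (2 - alpha))).

Definition w (t0 t : R) : R :=
  if t <= t0 then u0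
  else u0 * t0 `^ (alpha / gamma) * t `^ (- (alpha / gamma)).

End barriers.

(* Main.v *)
Require Import Defs.
From HB Require Import structures.
From mathcomp Require Import all_boot all_order all_algebra.
From mathcomp Require Import all_classical all_reals all_analysis.
From mathcomp Require Import measurable_realfun ring lra.
Set Implicit Arguments.
Unset Strict Implicit.
Unset Printing Implicit Defensive.
Import Order.TTheory GRing.Theory Num.Theory.
Import numFieldNormedType.Exports.
Local Open Scope classical_set_scope.
Local Open Scope ring_scope.

(** A comparison argument needing no regularity of [u] beyond the given one.
    Let [k] be the kernel [g (1 - alpha)].  If [f] is maximal on [0, t] at [t] and
    [f t - f s = O(t - s)] from the left, then comparing [conv k f] at [t] and
    [t - h] gives [(k * f)'(t) >= k t * f t], because [k] decreases and has an
    integrable singularity.  If [v <= u] failed, such a point [t], at which moreover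
    [v t > u t] and the equation holds, would exist: [d := v - u] has increments
    bounded by an integral (as [u] is in W^{1,1}), so the points where [d] attains
    a positive running maximum cannot all lie in a null set.  There [u0 - u] is
    maximal too, hence
    [nu u^gamma = (k * (u0 - u))' >= k (u0 - u) > k (u0 - v) >= nu v^gamma],
    which contradicts [u t < v t].  The bound [u <= w] is obtained in the same way
    from [d := u - w], the increments of [k * (u0 - w)] being estimated by splitting
    the convolution at [t / 2]. *)

(** * Reflections of the real line *)

(** The equation holds almost everywhere only, and so does the left Lipschitz bound, whereas a
    maximum point of [d] is a single point that could lie in the exceptional set. What excludes this
    is that [d] must climb from a value at most 0 to a positive one through its running maxima, and
    a climb governed by an integral cannot take place inside a null set.

    The barriers are never differentiated fractionally: [v] enters through a pointwise inequality,
    [w] through a bound on left difference quotients. For large [t] both inequalities compare a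
    power [gamma] of the barrier with a multiple of [t^(-alpha)], hence the exponent
    [alpha / gamma]. The constants match coefficients: [mu] makes [k (u0 - v)] equal to
    [nu u0^gamma] up to [eps], [eps] is the time at which [v] has fallen to [u0 / 2], and [t0^alpha]
    collects what the two halves of the split convolution produce. Of [Gamma] only positivity and
    [Gamma (p + 1) <= p * Gamma p] are needed. *)

Section reflection.
Context {R : realType}.
Notation mu := (@lebesgue_measure R).
Implicit Types (f : R -> R) (a b c : R).

Let refl c : measurableTypeR R -> measurableTypeR R := fun s : R => c - s.

Let measurable_refl c : measurable_fun setT (refl c).
Proof. by apply: measurable_funB; [exact: measurable_cst|exact: measurable_id]. Qed.

Let refl_preimage c a b (x y : bool) :
  refl c @^-1` [set` Interval (BSide x a) (BSide y b)] =
  [set` Interval (BSide (~~ y) (c - b)) (BSide (~~ x) (c - a))].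
Proof.
apply/seteqP; split => s; rewrite /refl /= !in_itv /=; case: x; case: y => /=;
 by move=> /andP[? ?]; apply/andP; split; lra.
Qed.

(** A reflection swaps the open and closed ends of an interval but keeps its length, and lengths of
    intervals determine the measure. *)
Lemma lebesgue_measure_reflection c (A : set R) : measurable A ->
  pushforward mu (refl c) A = mu A.
Proof.
move=> mA; apply/esym/lebesgue_measure_unique => //= _ [[a b]] _ <-.
rewrite /pushforward refl_preimage/= !lebesgue_measure_itv/=.
rewrite !lte_fin ltrD2l ltrN2; case: ifPn => // _.
by rewrite -!EFinB; congr (_%:E); lra.
Qed.

Lemma ge0_integral_reflection c (f : R -> \bar R) (a b : R) (x y : bool) :
  measurable_fun [set: R] f -> (forall s, 0 <= f s)%E ->
  (\int[mu]_(s in [set` Interval (BSide (~~ y) (c - b)%R) (BSide (~~ x) (c - a)%R)])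
     f (c - s)%R =
  \int[mu]_(s in [set` Interval (BSide x a) (BSide y b)]) f s)%E.
Proof.
move=> mf f0; rewrite -refl_preimage.
set D := [set` _].
transitivity (\int[pushforward mu (refl c)]_(s in D) f s)%E.
  apply/esym/(ge0_integral_pushforward (measurable_refl c)) => //.
    exact: measurable_itv.
  exact: measurable_funTS.
by apply: eq_measure_integral => //= A mA _; exact: lebesgue_measure_reflection.
Qed.

Lemma integrable_reflection c a b f :
  mu.-integrable `[a, b] (EFin \o f) ->
  mu.-integrable `[c - b, c - a] (EFin \o (fun s => f (c - s))).
Proof.
move=> intf; set D := `[a, b]%classic.
(* [f] is controlled on [[a, b]] only; its extension by zero is measurable on the whole line, so
   that it can be composed with the reflection. *)
have intfD : mu.-integrable setT ((EFin \o f) \_ D).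
  have mD : measurable D by exact: measurable_itv.
  exact: (@integrable_mkcond _ _ _ mu D (EFin \o f) mD).1 intf.
have mfD := measurable_int _ intfD.
have E : {in `[c - b, c - a]%classic, ((EFin \o f) \_ D) \o refl c =1
    EFin \o (fun s => f (c - s))}.
  move=> s; rewrite inE /= => sD; rewrite patchE mem_set//=.
  by move: sD; rewrite /D /refl /= !in_itv/= => /andP[? ?]; apply/andP; split; lra.
have mD' : measurable `[c - b, c - a]%classic by exact: measurable_itv.
apply: (@eq_integrable _ _ _ mu _ mD' _ _ E).
apply/integrableP; split.
  apply: measurable_funTS; apply: (measurableT_comp mfD).
  exact: measurable_refl.
move/integrableP: intf => [_]; apply: le_lt_trans.
have := @ge0_integral_reflection c (fun s => `|((EFin \o f) \_ D) s|)%E a b true false.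
move=> /= -> //; last first.
  exact: measurableT_comp.
rewrite le_eqVlt; apply/orP; left; apply/eqP.
by apply: eq_integral => s sD; rewrite patchE sD.
Qed.

Lemma Rintegral_reflection c a b f :
  mu.-integrable `[a, b] (EFin \o f) ->
  \int[mu]_(s in `[c - b, c - a]) f (c - s) = \int[mu]_(s in `[a, b]) f s.
Proof.
move=> intf; set D := `[a, b]%classic.
have intfD : mu.-integrable setT ((EFin \o f) \_ D).
  have mD : measurable D by exact: measurable_itv.
  exact: (@integrable_mkcond _ _ _ mu D (EFin \o f) mD).1 intf.
have mfD := measurable_int _ intfD.
congr fine.
have E : {in `[c - b, c - a]%classic, ((EFin \o f) \_ D) \o refl c =1
    EFin \o (fun s => f (c - s))}.
  move=> s; rewrite inE /= => sD; rewrite patchE mem_set//=.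
  by move: sD; rewrite /D /refl /= !in_itv/= => /andP[? ?]; apply/andP; split; lra.
transitivity (\int[mu]_(s in `[(c - b)%R, (c - a)%R])
    (((EFin \o f) \_ D) \o refl c) s)%E.
  by apply/esym; exact: (@eq_integral _ _ _ mu _ _ _ E).
transitivity (\int[mu]_(s in D) (((EFin \o f) \_ D) s))%E; last first.
  by apply: eq_integral => s sD; rewrite patchE sD.
have := @refl_preimage c a b true false => /= <-.
have -> := esym (@integral_pushforward _ _ _ _ _ _ (measurable_refl c) mu D _ mfD _ _).
  by apply: eq_measure_integral => //= A mA _; exact: lebesgue_measure_reflection.
rewrite (refl_preimage c a b true false) /=.
have mD' : measurable `[c - b, c - a]%classic by exact: measurable_itv.
apply: (@eq_integrable _ _ _ mu _ mD' (EFin \o (fun s => f (c - s)))).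
  by move=> s sI; rewrite E.
  exact: integrable_reflection.
exact: measurable_itv.
Qed.

End reflection.

(** * The Gamma function *)

Section gamma_function.
Context {R : realType}.
Notation mu := (@lebesgue_measure R).
Implicit Types (f F : R -> R) (a b x s p : R).

Lemma derivable_FTC2 F f a b : a < b ->
  (forall x, a <= x <= b -> is_derive x 1 F (f x)) ->
  {within `[a, b], continuous f} ->
  (\int[mu]_(x in `[a, b]) (f x)%:E = (F b)%:E - (F a)%:E)%E.
Proof.
move=> ab dF cf; apply: continuous_FTC2 => //.
  have cF x : a <= x <= b -> {for x, continuous F}.
    move=> /dF [dFx _].
    by apply: differentiable_continuous; exact/derivable1_diffP.
  split.
  - by move=> x; rewrite in_itv/= => /andP[ax xb]; have [] := dF x; rewrite ?ltW.
  - by apply: cvg_at_right_filter; apply: cF; rewrite lexx ltW.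
  - by apply: cvg_at_left_filter; apply: cF; rewrite lexx ltW.
move=> x; rewrite in_itv/= => /andP[ax xb]; rewrite derive1E.
by have [|_ ->] := dF x; rewrite ?ltW.
Qed.

(** Monotone convergence along [[1 / (n + 1), n + 2]] reduces a bound on an improper integral to
    compact intervals away from 0, where the fundamental theorem of calculus applies. The right end
    [n + 2] keeps these intervals nondegenerate from [n = 0] on. *)
Lemma ge0_integral_le_exhaustion (D : set R) f (M : \bar R) : measurable D ->
  D `<=` `]0, +oo[ -> measurable_fun D f -> (forall x, D x -> 0 <= f x) ->
  (forall a b, 0 < a -> a < b ->
    (\int[mu]_(x in D `&` `[a, b]) (f x)%:E <= M)%E) ->
  (\int[mu]_(x in D) (f x)%:E <= M)%E.
Proof.
move=> mD D0 mf f0 H.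
pose F (n : nat) := D `&` `[n.+1%:R^-1, n.+2%:R].
have mF n : measurable (F n) by apply: measurableI => //; exact: measurable_itv.
have DF : \bigcup_n F n = D.
  apply/seteqP; split => [x [n _] []//|x Dx].
  have x0 : 0 < x by have := D0 _ Dx; rewrite /= in_itv/= andbT.
  near \oo => n; exists n => //; split => //=; rewrite in_itv/=; apply/andP; split.
    rewrite -[leRHS]invrK lef_pV2 ?posrE ?invr_gt0//.
    rewrite (@le_trans _ _ n%:R)// ?ler_nat//.
    by near: n; exact: nbhs_infty_ger.
  rewrite (@le_trans _ _ n%:R)// ?ler_nat//; last by rewrite ltnW.
  by near: n; exact: nbhs_infty_ger.
have cvgF : ((\int[mu]_(x in F n) (f x)%:E) @[n --> \oo] -->
    \int[mu]_(x in \bigcup_n F n) (f x)%:E)%E.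
  apply: ge0_nondecreasing_set_cvg_integral => //.
  - apply/nondecreasing_seqP => n; apply/subsetPset; apply: setIS.
    apply: subset_itv; rewrite bnd_simp ?ler_nat// lef_pV2 ?posrE//.
    by rewrite ler_nat.
  - move=> n; apply/measurable_EFinP.
    by apply: measurable_funS mf => //; exact: subIsetl.
  - by move=> n x [Dx _]; rewrite lee_fin f0.
rewrite -{1}DF -(cvg_lim _ cvgF)//.
apply: lime_le; first by apply/cvg_ex; eexists; exact: cvgF.
apply: nearW => n; apply: H; rewrite ?invr_gt0//.
by rewrite (@le_lt_trans _ _ 1) ?ltr1n// invf_le1// ler1n.
Unshelve. all: by end_near. Qed.

(** The integrand of [Gamma (p + 1)]; its derivative contains the integrand of [Gamma p], which is
    the integration by parts behind the functional equation. *)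
Let h p s := s `^ p * expR (- s).

Let is_derive_h p s : 0 < s ->
  is_derive s 1 (h p) (p * h (p - 1) s - h p s).
Proof.
move=> s0.
have d1 := is_derive1_powR p s0.
have d2 : is_derive s 1 (fun s : R => expR (- s)) (- expR (- s)).
  by apply: is_derive_eq; rewrite mulrN1.
have d3 := is_deriveM d1 d2.
by apply: (is_derive_eq d3); rewrite /h /GRing.scale/=; ring.
Qed.

Let h_ge0 p s : 0 <= h p s.
Proof. by rewrite mulr_ge0 ?powR_ge0 ?expR_ge0. Qed.

Let continuous_h p a b : 0 < a -> {within `[a, b], continuous (h p)}.
Proof.
move=> a0; apply: derivable_within_continuous => x; rewrite in_itv/= => /andP[ax _].
by have [] := is_derive_h p (lt_le_trans a0 ax).
Qed.

Let measurable_h p : measurable_fun setT (h p).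
Proof.
apply: measurable_funM; first exact: measurable_powR.
by apply: measurableT_comp => //; exact: measurable_funN.
Qed.

Lemma integral_powR_le b p : 0 < b -> 0 < p ->
  (\int[mu]_(s in `[0%R, b]) (s `^ (p - 1))%:E <= (b `^ p / p)%:E)%E.
Proof.
move=> b0 p0; rewrite -integral_itv_obnd_cbnd; last first.
  by apply/measurable_EFinP; apply: measurable_funTS; exact: measurable_powR.
apply: ge0_integral_le_exhaustion => //.
- by move=> x; rewrite /= !in_itv/= => /andP[->].
- by apply: measurable_funTS; exact: measurable_powR.
- by move=> *; exact: powR_ge0.
move=> a c a0 ac.
apply: (@le_trans _ _ (\int[mu]_(s in `[a, b]) (s `^ (p - 1))%:E)%E).
  apply: ge0_subset_integral => //.
  - by apply: measurableI; exact: measurable_itv.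
  - apply/measurable_EFinP; apply: measurable_funTS; exact: measurable_powR.
  - by move=> *; rewrite lee_fin powR_ge0.
  - by move=> x [] /=; rewrite !in_itv/= => /andP[_ ->] /andP[->].
have [ab|ba|->] := ltgtP a b; last 2 first.
- by rewrite set_itv_ge ?bnd_simp -?ltNge// integral_set0 lee_fin divr_ge0 ?powR_ge0// ltW.
- by rewrite set_itv1 integral_set1 lee_fin divr_ge0 ?powR_ge0// ltW.
have -> : (\int[mu]_(s in `[a, b]) (s `^ (p - 1))%:E =
    (b `^ p / p)%:E - (a `^ p / p)%:E)%E; last first.
  by rewrite -EFinB lee_fin lerBlDr lerDl divr_ge0 ?powR_ge0// ltW.
apply: (@derivable_FTC2 (fun s => s `^ p / p)) => //.
- move=> x /andP[ax _]; have x0 := lt_le_trans a0 ax.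
  have d := is_derive1_powR p x0.
  have := is_deriveZ p^-1 d.
  rewrite scalerA mulVf ?gt_eqF// scale1r => H.
  have -> // : (fun s : R => s `^ p / p) = p^-1 \*: (fun s : R => s `^ p).
  by apply/funext => s /=; rewrite mulrC.
- apply: derivable_within_continuous => x; rewrite in_itv/= => /andP[ax _].
  by apply: derivable_powR; rewrite in_itv/= andbT (lt_le_trans a0).
Qed.


(** The integral is kept in the extended reals because [Gamma] takes its [fine] part, which would be
    0 for an infinite value; positivity of [Gamma] therefore includes finiteness here. *)
Let eGamma p : \bar R := (\int[mu]_(s in `]0%R, +oo[) (h (p - 1) s)%:E)%E.

Let GammaE p : Gamma p = fine (eGamma p). Proof. by []. Qed.

Let eGamma_ge0 p : (0 <= eGamma p)%E.
Proof. by apply: integral_ge0 => s _; rewrite lee_fin h_ge0. Qed.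

Let setI_pos_itv a b : 0 < a -> `]0, +oo[ `&` `[a, b] = `[a, b]%classic.
Proof.
move=> a0; apply/seteqP; split => [x []//|x /= xab]; split => //.
by move: xab; rewrite /= !in_itv/= andbT => /andP[ax _]; exact: lt_le_trans ax.
Qed.

Let le_eGamma p a b : 0 < a ->
  (\int[mu]_(s in `[a, b]) (h (p - 1) s)%:E <= eGamma p)%E.
Proof.
move=> a0; apply: ge0_subset_integral => //.
- by apply/measurable_EFinP; apply: measurable_funTS; exact: measurable_h.
- by move=> *; rewrite lee_fin h_ge0.
- by rewrite -(setI_pos_itv _ a0); exact: subIsetl.
Qed.

Let eGamma_gt0 p : 0 < p -> (0 < eGamma p)%E.
Proof.
move=> p0; apply: lt_le_trans (le_eGamma p 2 ltr01).
(* On [[1, 2]] one has [s^(p - 1) >= 1 / s >= 1 / 2] for every [p > 0], and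
   [expR (- s) >= expR (- 2)]. *)
apply: (@lt_le_trans _ _ (\int[mu]_(s in `[1%R, 2%R]) (expR (- 2) / 2)%:E)%E).
  rewrite integral_cst//= lebesgue_measure_itv/= lte_fin ltr1n -EFinB -EFinM.
  by rewrite lte_fin mulr_gt0 ?divr_gt0 ?expR_gt0//; lra.
apply: ge0_le_integral => //.
- apply/measurable_EFinP; apply: measurable_funTS; exact: measurable_h.
move=> s; rewrite /= in_itv/= => /andP[s1 s2].
rewrite lee_fin mulrC ler_pM ?expR_ge0 ?invr_ge0//.
  apply: (@le_trans _ _ (s `^ (-1))); last by rewrite ler_powR//; lra.
  by rewrite powR_inv1 ?lef_pV2 ?posrE//; lra.
by rewrite ler_expR lerN2.
Qed.

(** For [p < 1] each factor of the integrand is at most 1 on one side of 1: the exponential on []0,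
    1]], leaving [1 / p], and the power on []1, +oo[], leaving at most 1. *)
Let eGamma_fin01 p : 0 < p -> p < 1 -> (eGamma p < +oo)%E.
Proof.
move=> p0 p1.
apply: (@le_lt_trans _ _ (p^-1%:E + 1)%E); last by rewrite ltry.
have mh D : measurable_fun D (EFin \o h (p - 1)).
  by apply/measurable_EFinP; apply: measurable_funTS; exact: measurable_h.
have : `]0, +oo[%classic = `]0, 1] `|` `]1, +oo[ :> set R.
  by rewrite -itv_bndbnd_setU ?bnd_simp.
rewrite /eGamma => ->; rewrite ge0_integral_setU//=; first last.
- by apply/disj_setPS => s []/=; rewrite !in_itv/= => /andP[_ ?] /andP[?]; lra.
- by move=> s _; rewrite lee_fin h_ge0.
- exact: mh.
apply: leeD.
  rewrite integral_itv_obnd_cbnd//.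
  apply: (@le_trans _ _ (1 `^ p / p)%:E); last by rewrite powR1 div1r.
  apply: le_trans (integral_powR_le ltr01 p0).
  apply: ge0_le_integral => //.
  - by move=> *; rewrite lee_fin h_ge0.
  - exact: mh.
  - by apply/measurable_EFinP; apply: measurable_funTS; exact: measurable_powR.
  - move=> s; rewrite /= in_itv/= => /andP[s0 _]; rewrite lee_fin.
    by rewrite ler_piMr ?powR_ge0// -expR0 ler_expR oppr_le0.
apply: ge0_integral_le_exhaustion => //.
- by move=> s; rewrite /= !in_itv/= !andbT; apply: lt_trans.
- by apply: measurable_funTS; exact: measurable_h.
move=> a b a0 ab.
have me : measurable_fun setT (fun s : R => expR (- s)).
  by apply: measurableT_comp => //; exact: measurable_funN.
apply: (@le_trans _ _ (\int[mu]_(s in `[a, b]) (expR (- s))%:E)%E).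
  apply: (@le_trans _ _ (\int[mu]_(s in `]1%R, +oo[ `&` `[a, b]) (expR (- s))%:E)%E).
    apply: ge0_le_integral => //.
    - by apply: measurableI; exact: measurable_itv.
    - by move=> *; rewrite lee_fin h_ge0.
    - exact: mh.
    - by apply/measurable_EFinP; apply: measurable_funTS.
    move=> s [] /=; rewrite !in_itv/= andbT => s1 _.
    rewrite lee_fin ler_piMl ?expR_ge0// -[leRHS](powRr0 s) ler_powR ?ltW//.
    by rewrite subr_lt0.
  apply: ge0_subset_integral => //.
  - by apply: measurableI; exact: measurable_itv.
  - by apply/measurable_EFinP; apply: measurable_funTS.
have -> : (\int[mu]_(s in `[a, b]) (expR (- s))%:E =
    (- expR (- b))%:E - (- expR (- a))%:E)%E; last first.
  rewrite -EFinB lee_fin opprK -[leRHS]add0r lerD ?oppr_le0 ?expR_ge0//.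
  by rewrite -expR0 ler_expR oppr_le0 ltW.
apply: (@derivable_FTC2 (fun s => - expR (- s))) => //.
- by move=> x _; apply: is_derive_eq; rewrite mulrN1 opprK.
- apply: derivable_within_continuous => x _.
  by apply: (@ex_derive _ _ _ _ _ _ (- expR (- x))); apply: is_derive_eq; rewrite mulrN1.
Qed.

(** Integration by parts on [[c, b]]: the boundary term at [b] has the right sign and is dropped,
    the one at [c] is made smaller than [e]. One inequality suffices, both for finiteness on
    [(1, 2)] and for the constant of the upper barrier. *)
Let eGammaD1_le p : 0 < p -> (eGamma (p + 1) <= p%:E * eGamma p)%E.
Proof.
move=> p0; apply/lee_addgt0Pr => e e0.
apply: ge0_integral_le_exhaustion => //.
- by apply: measurable_funTS; exact: measurable_h.
move=> a b a0 ab; rewrite setI_pos_itv//.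
(* This choice gives [c^p <= e], hence a boundary term [h p c <= e]. *)
pose c := Num.min a (e `^ p^-1).
have c0 : 0 < c by rewrite lt_min a0 powR_gt0.
have cb : c < b by rewrite (le_lt_trans _ ab)// ge_min lexx.
have mh q D : measurable_fun D (EFin \o h q).
  by apply/measurable_EFinP; apply: measurable_funTS; exact: measurable_h.
have ih q : mu.-integrable `[c, b] (EFin \o h q).
  apply: continuous_compact_integrable; first exact: segment_compact.
  exact: continuous_h.
rewrite addrK.
apply: (@le_trans _ _ (\int[mu]_(s in `[c, b]) (h p s)%:E)%E).
  apply: ge0_subset_integral => //.
  - exact: mh.
  - by move=> *; rewrite lee_fin h_ge0.
  by apply: subset_itv; rewrite bnd_simp// ge_min lexx.
have -> : (\int[mu]_(s in `[c, b]) (h p s)%:E =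
  p%:E * \int[mu]_(s in `[c, b]) (h (p - 1) s)%:E +
  \int[mu]_(s in `[c, b]) (h p s - p * h (p - 1) s)%:E)%E.
  under [X in (_ = _ + X)%E]eq_integral do rewrite EFinB.
  have ip : mu.-integrable `[c, b] (EFin \o (fun s => p * h (p - 1) s)).
    by apply: (integrableZl _ p (ih (p - 1))).
  rewrite integralB_EFin//.
  under [X in (_ - X)%E]eq_integral do rewrite EFinM.
  rewrite integralZl//; last exact: ih.
  by rewrite addeC subeK// fin_numM// integrable_fin_num//; exact: ih.
apply: leeD.
  by apply: lee_wpmul2l; [rewrite lee_fin ltW|exact: le_eGamma].
have -> : (\int[mu]_(s in `[c, b]) (h p s - p * h (p - 1) s)%:E =
    (- h p b)%:E - (- h p c)%:E)%E; last first.
  rewrite -EFinB lee_fin opprK -[leRHS]add0r lerD ?oppr_le0//.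
  rewrite (@le_trans _ _ (c `^ p))//.
    by rewrite ler_piMr ?powR_ge0// -expR0 ler_expR oppr_le0 ltW.
  rewrite (@le_trans _ _ ((e `^ p^-1) `^ p))//.
    by apply: ge0_ler_powR; rewrite ?nnegrE ?(ltW c0) ?(ltW p0) ?powR_ge0// ge_min lexx orbT.
  by rewrite -powRrM mulVf ?gt_eqF// powRr1// ltW.
apply: (@derivable_FTC2 (fun s => - h p s)) => //.
- move=> x /andP[cx _].
  by have /is_deriveN := is_derive_h p (lt_le_trans c0 cx); rewrite opprB.
- move=> x; apply: continuousB.
    exact: continuous_h.
  by apply: continuousM; [exact: cst_continuous|exact: continuous_h].
Qed.

(** Finiteness is direct on [(0, 1)] and carried to [(1, 2)] by the recursion; the arguments
    [1 - alpha], [1 + alpha] and [2 - alpha] all lie in these two intervals. *)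
Lemma Gamma_gt0 p : 0 < p -> p < 2 -> p != 1 -> 0 < Gamma p.
Proof.
move=> p0 p2 p1; rewrite GammaE fine_gt0// eGamma_gt0//=.
have [p_lt1|p_gt1|/eqP] := ltgtP p 1; last by rewrite (negbTE p1).
  exact: eGamma_fin01.
have p_gt1' : 0 < p - 1 by rewrite subr_gt0.
have /le_lt_trans := eGammaD1_le p_gt1'; rewrite subrK; apply.
by rewrite lte_mul_pinfty ?lee_fin ?(ltW p_gt1')// eGamma_fin01//; lra.
Qed.

Lemma GammaD1_le p : 0 < p -> p < 1 -> Gamma (p + 1) <= p * Gamma p.
Proof.
move=> p0 p1.
have fG : (eGamma p \is a fin_num)%E by rewrite ge0_fin_numE// eGamma_fin01.
have fpG : (p%:E * eGamma p \is a fin_num)%E by rewrite fin_numM.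
rewrite !GammaE -[p in leRHS]/(fine p%:E) -fineM//.
have le := eGammaD1_le p0.
have fG1 : (eGamma (p + 1) \is a fin_num)%E.
  rewrite (ge0_fin_numE (eGamma_ge0 _)); apply: le_lt_trans le _.
  by rewrite ltey_eq fpG.
exact: (fine_le fG1 fpG le).
Qed.

End gamma_function.

(** * Increments of convolutions with a decreasing kernel *)

Section real_integrals.
Context {R : realType}.
Notation mu := (@lebesgue_measure R).
Implicit Types f : R -> R.

Lemma ge0_Rintegral_subset f (A B : set R) : measurable A -> measurable B ->
  mu.-integrable B (EFin \o f) -> (forall x, B x -> 0 <= f x) -> A `<=` B ->
  \int[mu]_(x in A) f x <= \int[mu]_(x in B) f x.
Proof.
move=> mA mB fB f0 AB; apply: fine_le.
- by apply: integrable_fin_num => //; exact: integrableS fB.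
- exact: integrable_fin_num.
- apply: ge0_subset_integral => //; first exact: measurable_int fB.
Qed.

Lemma integrable_continuous_mull (f1 f2 : R -> R) (A : set R) : compact A ->
  mu.-integrable A (EFin \o f1) -> {within A, continuous f2} ->
  mu.-integrable A (EFin \o (fun s => f1 s * f2 s)).
Proof.
move=> cA i1 c2.
have mA : measurable A by exact: compact_measurable.
have [M [Mreal Mf2]] := compact_bounded (continuous_compact c2 cA).
apply: (@integrableMl _ _ _ mu A mA (EFin \o f1) f2 i1).
  exact: subspace_continuous_measurable_fun.
by exists M; split => // x Mx s As; apply: (Mf2 _ Mx); exists s.
Qed.

End real_integrals.

Section convolution.
Context {R : realType} (k : R -> R).
Notation mu := (@lebesgue_measure R).
Local Notation conv := (@Defs.conv R).
Hypothesis k_ge0 : forall s, 0 <= k s.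
Hypothesis k_decr : forall s t, 0 < s -> s <= t -> k t <= k s.
Hypothesis k_int : forall T, mu.-integrable `[0, T] (EFin \o k).
Implicit Types (f W : R -> R) (t h C L : R).

(** For the kernel [g (1 - alpha)] this is the function [g_(2 - alpha)]. *)
Definition mass t : R := \int[mu]_(s in `[0, t]) k s.

Let integrable_kshift a b c : 0 <= c - b ->
  mu.-integrable `[a, b] (EFin \o (fun s => k (c - s))).
Proof.
move=> cb; have := @integrable_reflection R c 0 (c - a) k (k_int _).
rewrite subKr subr0; apply: integrableS => //.
by apply: subset_itvl; rewrite bnd_simp; lra.
Qed.

Lemma integrable_conv f a b c : b <= c -> {within `[a, b], continuous f} ->
  mu.-integrable `[a, b] (EFin \o (fun s => k (c - s) * f s)).
Proof.
move=> bc cf; apply: integrable_continuous_mull => //; first exact: segment_compact.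
by apply: integrable_kshift; rewrite subr_ge0.
Qed.

Let mass_reflection t h : \int[mu]_(s in `[t - h, t]) k (t - s) = mass h.
Proof. by have := @Rintegral_reflection R t 0 h k (k_int _); rewrite subr0. Qed.

Lemma mass_increment t h : 0 < h -> h < t -> h * k t <= mass t - mass (t - h).
Proof.
move=> h0 ht; rewrite /mass (Rintegral_itvB (k_int t)) ?bnd_simp; [|lra..].
have ik : mu.-integrable `]t - h, t] (EFin \o k).
  by apply: integrableS (k_int t) => //; apply: subset_itvr; rewrite bnd_simp; lra.
rewrite (_ : h * k t = \int[mu]_(s in `]t - h, t]) k t).
  apply: le_Rintegral => //.
  - apply: (@integrableS _ _ _ mu `[t - h, t]) => //.
      by apply: subset_itvr; rewrite bnd_simp.
    apply: continuous_compact_integrable; first exact: segment_compact.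
    by move=> x; exact: cst_continuous.
  - by move=> s; rewrite /= in_itv/= => /andP[hs st]; apply: k_decr => //; lra.
rewrite Rintegral_cst//= lebesgue_measure_itv/= lte_fin.
by rewrite ifT; [rewrite -EFinB/=; ring|lra].
Qed.

Lemma convB (f1 f2 : R -> R) t : {within `[0, t], continuous f1} ->
  {within `[0, t], continuous f2} ->
  conv k (fun s => f1 s - f2 s) t = conv k f1 t - conv k f2 t.
Proof.
move=> c1 c2; rewrite /Defs.conv; under eq_Rintegral do rewrite mulrBr.
by rewrite RintegralB//; exact: integrable_conv.
Qed.

Let conv_sub f c t : 0 <= t -> {within `[0, t], continuous f} ->
  conv k (fun s => c - f s) t = c * mass t - conv k f t.
Proof.
move=> t0 cf.
have cc : {within `[0, t], continuous (fun=> c : R)} by move=> x; exact: cst_continuous.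
rewrite convB// /Defs.conv.
rewrite RintegralZr//; last by apply: integrable_kshift; lra.
congr (_ - _); rewrite mulrC -(mass_reflection t t); congr (_ * Rintegral _ _ _).
by rewrite subrr.
Qed.

(* The increment of [conv k (f t - f)] is controlled by the mass of [k] near its
   singularity, because [k] decreases and [f t - f] is small near [t]. *)
Lemma conv_increment_ge f C t h : 0 < h -> h < t -> 0 <= C ->
  {within `[0, t], continuous f} ->
  (forall s, 0 <= s <= t -> f s <= f t) ->
  (forall s, t - h <= s <= t -> f t - f s <= C * (t - s)) ->
  f t * (mass t - mass (t - h)) - C * h * mass h <=
  conv k f t - conv k f (t - h).
Proof.
move=> h0 ht C0 cf fle fC.
have cf' : {within `[0, t - h], continuous f}.
  by apply: continuous_subspaceW cf; apply: subset_itvl; rewrite bnd_simp; lra.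
pose e s := f t - f s.
have ce a b : 0 <= a -> b <= t -> {within `[a, b], continuous e}.
  move=> a0 bt; apply: (@continuous_subspaceW _ _ _ `[0, t]).
    by apply: subset_itv; rewrite bnd_simp.
  by move=> x; apply: continuousB; [exact: cst_continuous|exact: cf].
have E1 := @conv_sub f (f t) t _ cf.
have E2 := @conv_sub f (f t) (t - h) _ cf'.
(* By [E1] and [E2], with the same constant [f t] at both times, the claim on [f] is this claim on
   the gap [e], which is nonnegative and small near [t]. *)
suff : conv k e t - conv k e (t - h) <= C * h * mass h.
  rewrite /e E1 ?E2; lra.
have -> : conv k e t = \int[mu]_(s in `[0, t - h[) (k (t - s) * e s) +
    \int[mu]_(s in `[t - h, t]) (k (t - s) * e s).
  rewrite /Defs.conv (@itv_bndbnd_setU _ _ _ (BLeft (t - h))) ?bnd_simp; [|lra..].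
  rewrite Rintegral_setU//=.
    rewrite -itv_bndbnd_setU ?bnd_simp; [|lra..].
    by apply: integrable_conv => //; exact: ce.
  by apply/disj_setPS => s []/=; rewrite !in_itv/= => /andP[_ ?] /andP[?]; lra.
have le1 : \int[mu]_(s in `[0, t - h[) (k (t - s) * e s) <= conv k e (t - h).
  rewrite /Defs.conv -Rintegral_itv_bndo_bndc; last first.
    apply: (@integrableS _ _ _ mu `[0, t - h]) => //.
      by apply: subset_itvl; rewrite bnd_simp.
    by apply: integrable_conv => //; apply: ce => //; lra.
  apply: le_Rintegral => //.
  - apply: (@integrableS _ _ _ mu `[0, t - h]) => //.
      by apply: subset_itvl; rewrite bnd_simp.
    by apply: integrable_conv; [lra|apply: ce => //; lra].
  - apply: (@integrableS _ _ _ mu `[0, t - h]) => //.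
      by apply: subset_itvl; rewrite bnd_simp.
    by apply: integrable_conv => //; apply: ce => //; lra.
  move=> s; rewrite /= in_itv/= => /andP[s0 sth]; apply: ler_wpM2r.
    by rewrite /e subr_ge0 fle//; lra.
  by apply: k_decr; lra.
have le2 : \int[mu]_(s in `[t - h, t]) (k (t - s) * e s) <= C * h * mass h.
  rewrite mulrC -(mass_reflection t h) -RintegralZr//; last first.
    by apply: integrable_kshift; rewrite subrr.
  apply: le_Rintegral => //.
  - by apply: integrable_conv => //; apply: ce; lra.
  - apply: integrable_continuous_mull; first exact: segment_compact.
      by apply: integrable_kshift; rewrite subrr.
    by move=> x; exact: cst_continuous.
  move=> s; rewrite /= in_itv/= => /andP[ths st]; apply: ler_wpM2l => //.
  by rewrite /e (le_trans (fC s _)) ?ths// ler_wpM2l//; lra.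
by lra.
Qed.

Let conv_reflection f t : 0 <= t -> {within `[0, t], continuous f} ->
  conv k f t = \int[mu]_(s in `[0, t]) (k s * f (t - s)).
Proof.
move=> t0 cf.
have := @Rintegral_reflection R t 0 t (fun s => k (t - s) * f s) (integrable_conv (lexx t) cf).
rewrite subrr subr0 /Defs.conv => <-.
by apply: eq_Rintegral => s _; rewrite subKr.
Qed.

(** Once reflected, the increment is the integral of [k s * (W (t - s) - W (t - h - s))]. For
    [s <= t / 2] the argument [t - s] is at least [t / 2], so the slope bound [L] applies; for
    [s >= t / 2] the kernel is at most [k (t / 2)] and the integrals of [W] telescope. *)
Lemma conv_increment_le W L t h : 0 < h -> h < t / 2 -> continuous W ->
  {homo W : x y / x <= y} -> (forall x, x <= 0 -> W x = 0) -> 0 <= L ->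
  (forall x, t / 2 <= x -> W x - W (x - h) <= L * h) ->
  conv k W t - conv k W (t - h) <= h * (L * mass (t / 2) + k (t / 2) * W (t / 2)).
Proof.
move=> h0 ht cW ndW W0 L0 WL.
have W_ge0 x : 0 <= W x.
  by have [/W0->//|x0] := leP x 0; rewrite -(W0 0) ?lexx// ndW// ltW.
have cWr c (A : set R) : {within A, continuous (fun s => W (c - s))}.
  apply: continuous_subspaceT => x; apply: (@continuous_comp _ _ _ (fun s => c - s) W).
    by apply: continuousB; [exact: cst_continuous|exact: cvg_id].
  exact: cW.
have ikW c (a b : R) : 0 <= a -> mu.-integrable `[a, b] (EFin \o (fun s => k s * W (c - s))).
  move=> a0; apply: integrable_continuous_mull => //; first exact: segment_compact.
  by apply: integrableS (k_int b) => //; apply: subset_itvr; rewrite bnd_simp.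
have iW c (a b : R) : mu.-integrable `[a, b] (EFin \o (fun s => W (c - s))).
  by apply: continuous_compact_integrable => //; exact: segment_compact.
have iW' (a b : R) : mu.-integrable `[a, b] (EFin \o W).
  apply: continuous_compact_integrable; first exact: segment_compact.
  exact: continuous_subspaceT.
(* Since [W] vanishes at nonpositive arguments, the integral extends from [[0, t - h]] to [[0, t]],
   and both convolutions share one domain. *)
have -> : conv k W (t - h) = \int[mu]_(s in `[0, t]) (k s * W (t - h - s)).
  rewrite conv_reflection; [|lra|exact: continuous_subspaceT].
  rewrite (@itv_bndbnd_setU _ _ (BLeft 0) (BRight (t - h)) (BRight t)) ?bnd_simp; [|lra..].
  rewrite Rintegral_setU//=; last 2 first.
  - by rewrite -itv_bndbnd_setU ?bnd_simp; [exact: ikW|lra..].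
  - by apply/disj_setPS => s []/=; rewrite !in_itv/= => /andP[_ ?] /andP[?]; lra.
  rewrite [X in _ = _ + X](_ : _ = 0) ?addr0//.
  rewrite (@eq_Rintegral _ _ _ mu _ (fun=> 0)) ?Rintegral_cst ?mul0r//.
  move=> s; rewrite inE/= in_itv/= => /andP[ts _]; rewrite W0 ?mulr0//; lra.
rewrite conv_reflection; [|lra|exact: continuous_subspaceT].
rewrite -RintegralB//; [|exact: ikW|exact: ikW].
pose D s := k s * W (t - s) - k s * W (t - h - s).
have iD a b : 0 <= a -> mu.-integrable `[a, b] (EFin \o D).
  by move=> a0; apply: (@integrableB _ _ _ mu _ _ _ _ (ikW t a b a0) (ikW (t - h) a b a0)).
rewrite -/D (@itv_bndbnd_setU _ _ (BLeft 0) (BRight (t / 2)) (BRight t)) ?bnd_simp; [|lra..].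
rewrite Rintegral_setU//=; last 2 first.
- by rewrite -itv_bndbnd_setU ?bnd_simp; [exact: iD|lra..].
- by apply/disj_setPS => s []/=; rewrite !in_itv/= => /andP[_ ?] /andP[?]; lra.
rewrite mulrDr lerD//.
  rewrite (_ : h * (L * mass (t / 2)) = mass (t / 2) * (L * h)); last by ring.
  rewrite -RintegralZr//; apply: le_Rintegral => //; first exact: iD.
    by apply: (@integrableZr _ _ _ mu _ _ (L * h) _ (k_int _)).
  move=> s; rewrite /= in_itv/= => /andP[s0 st].
  rewrite /D -mulrBr ler_wpM2l// (_ : t - h - s = t - s - h); last by ring.
  by apply: WL; lra.
rewrite Rintegral_itv_obnd_cbnd; last first.
  apply: (@integrableS _ _ _ mu `[0, t]) => //; last exact: iD.
  by apply: subset_itvr; rewrite bnd_simp; lra.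
have iWB : mu.-integrable `[t / 2, t] (EFin \o (fun s => W (t - s) - W (t - h - s))).
  by apply: (@integrableB _ _ _ mu _ _ _ _ (iW t _ _) (iW (t - h) _ _)).
apply: (@le_trans _ _ (k (t / 2) * \int[mu]_(s in `[t / 2, t]) (W (t - s) - W (t - h - s)))).
  rewrite -RintegralZl//; apply: le_Rintegral => //.
  - by apply: iD; lra.
  - by apply: (@integrableZl _ _ _ mu _ _ (k (t / 2)) _ iWB).
  move=> s; rewrite /= in_itv/= => /andP[ts st].
  rewrite /D -mulrBr ler_wpM2r//; first by rewrite subr_ge0 ndW//; lra.
  by apply: k_decr; lra.
rewrite mulrCA ler_wpM2l//.
rewrite RintegralB//.
have -> : \int[mu]_(s in `[t / 2, t]) W (t - s) = \int[mu]_(s in `[0, t / 2]) W s.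
  have := @Rintegral_reflection R t 0 (t / 2) W (iW' _ _).
  by rewrite subr0 (_ : t - t / 2 = t / 2)//; lra.
have -> : \int[mu]_(s in `[t / 2, t]) W (t - h - s) = \int[mu]_(s in `[- h, t / 2 - h]) W s.
  have := @Rintegral_reflection R (t - h) (- h) (t / 2 - h) W (iW' _ _).
  rewrite (_ : t - h - (t / 2 - h) = t / 2); last by lra.
  by rewrite (_ : t - h - - h = t)//; lra.
(* Dropping the part over negative arguments leaves an integral over an interval of length [h], on
   which [W] is at most [W (t / 2)]. *)
apply: (@le_trans _ _ (\int[mu]_(s in `[0, t / 2]) W s - \int[mu]_(s in `[0, t / 2 - h]) W s)).
  rewrite lerD2l lerN2; apply: ge0_Rintegral_subset => //.
  by apply: subset_itvr; rewrite bnd_simp; lra.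
rewrite Rintegral_itvB ?bnd_simp; [|exact: iW'|lra..].
rewrite (_ : h * W (t / 2) = \int[mu]_(s in `]t / 2 - h, t / 2]) W (t / 2)).
  apply: le_Rintegral => //.
  - apply: integrableS (iW' (t / 2 - h) (t / 2)) => //.
    by apply: subset_itvr; rewrite bnd_simp.
  - apply: (@integrableS _ _ _ mu `[t / 2 - h, t / 2]) => //.
      by apply: subset_itvr; rewrite bnd_simp.
    apply: continuous_compact_integrable; first exact: segment_compact.
    by move=> x; exact: cst_continuous.
  - by move=> s; rewrite /= in_itv/= => /andP[_ st]; exact: ndW.
rewrite Rintegral_cst//= lebesgue_measure_itv/= lte_fin.
by rewrite ifT; [rewrite -EFinB/=; ring|lra].
Qed.

(** As [mass h] tends to 0, the error [C * h * mass h] is [o(h)], so the left difference quotients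
    are eventually at least [k t * f t - e]. *)
Lemma conv_increment_at_max f C h0 t e : 0 < t -> 0 <= C -> 0 < h0 -> h0 < t ->
  (forall e, 0 < e -> exists2 h1, 0 < h1 & forall h, 0 < h < h1 -> mass h <= e) ->
  {within `[0, t], continuous f} -> 0 <= f t ->
  (forall s, 0 <= s <= t -> f s <= f t) ->
  (forall s, t - h0 <= s -> s < t -> f t - f s <= C * (t - s)) -> 0 < e ->
  exists2 h1, 0 < h1 &
    forall h, 0 < h < h1 -> h * (k t * f t - e) <= conv k f t - conv k f (t - h).
Proof.
move=> t0 C0 h00 h0t m0 cf ft0 fmax fC e0.
(* Dividing by [C + 1] rather than by [C] covers the case [C = 0]. *)
have [h1 h10 mh] := m0 (e / (C + 1)) (divr_gt0 e0 (ltr_wpDl C0 ltr01)).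
exists (Num.min h0 h1); first by rewrite lt_min h00.
move=> h /andP[h_gt0]; rewrite lt_min => /andP[hh0 hh1].
have ht : h < t by exact: lt_trans h0t.
apply: le_trans (conv_increment_ge h_gt0 ht C0 cf fmax _); last first.
  move=> s /andP[ths]; rewrite le_eqVlt => /predU1P[->|st]; first by rewrite !subrr mulr0.
  by apply: fC => //; lra.
have H1 : h * k t * f t <= (mass t - mass (t - h)) * f t.
  by rewrite ler_wpM2r// mass_increment.
have H2 : C * mass h <= e.
  apply: (@le_trans _ _ (C * (e / (C + 1)))).
    by rewrite ler_wpM2l// mh// h_gt0.
  rewrite mulrCA ler_piMr ?(ltW e0)// ler_pdivrMr ?mul1r; lra.
have H3 : h * (C * mass h) <= h * e by rewrite ler_pM2l.
lra.
Qed.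

End convolution.

(** * Running maxima outside a null set *)

Section left_increment.
Context {R : realType}.
Implicit Types (G : R -> R) (t A e : R).

Lemma derivable_left_increment G t e : derivable G t 1 -> 0 < e ->
  exists2 h0, 0 < h0 &
    forall h, 0 < h < h0 -> `|G t - G (t - h) - h * derive1 G t| <= e * h.
Proof.
move=> dG e0.
have cG : h^-1 *: (G (h *: 1 + t) - G t) @[h --> 0^'] --> derive1 G t.
  by rewrite derive1E; exact: dG.
have /cvgrPdist_le/(_ e e0) := cG.
move=> -[r /= r0 H]; exists r => // h /andP[h0 hr].
have := H (- h); rewrite /= sub0r opprK gtr0_norm// oppr_eq0 gt_eqF// => /(_ hr isT).
rewrite /GRing.scale/= mulr1 (addrC (- h)) invrN mulNr opprK => le.
rewrite -ler_pdivrMr//.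
rewrite -[X in _ / X](gtr0_norm h0) -normf_div -normrN.
apply: le_trans le; rewrite le_eqVlt; apply/orP; left; apply/eqP; congr (`|_|).
by field; rewrite gt_eqF.
Qed.

(** A maximum over [[0, t]] says nothing to the right of [t]; derivability being known, left
    quotients alone bound the derivative from below. *)
Lemma le_derive1_left_increment G t A : derivable G t 1 ->
  (forall e, 0 < e -> exists2 h1, 0 < h1 &
    forall h, 0 < h < h1 -> h * (A - e) <= G t - G (t - h)) ->
  A <= derive1 G t.
Proof.
move=> dG H; apply/ler_addgt0Pr => e e0; have e20 : 0 < e / 2 by rewrite divr_gt0.
have [h1 h10 H1] := H _ e20.
have [h2 h20 H2] := derivable_left_increment dG e20.
pose h := Num.min (h1 / 2) (h2 / 2).
have h0 : 0 < h by rewrite lt_min !divr_gt0.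
have hh1 : h < h1 by rewrite gt_min; apply/orP; left; lra.
have hh2 : h < h2 by rewrite gt_min; apply/orP; right; lra.
have {}H1 := H1 h; have {}H2 := H2 h.
rewrite h0 hh1 in H1; rewrite h0 hh2 ler_norml in H2.
have {}H1 := H1 isT; have /andP[_ {}H2] := H2 isT.
rewrite -(ler_pM2l h0); lra.
Qed.

End left_increment.

Section maximum_avoiding_null_set.
Context {R : realType}.
Notation mu := (@lebesgue_measure R).

(* Penalising [d] by the integral of [f] over a small open neighbourhood [U] of
   the exceptional null set forces a maximum point of the penalised function out
   of [U], while the penalty, being nondecreasing in [t], keeps [d] maximal on
   [0, t]. *)
Lemma exists_ae_running_max (P : R -> Prop) (d f : R -> R) (T : R) :
  {ae mu, forall x, P x} -> 0 < T -> {within `[0, T], continuous d} ->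
  mu.-integrable `[0, T] (EFin \o f) -> (forall x, 0 <= f x) ->
  (forall s t, 0 < s -> s < t -> t <= T ->
    d t - d s <= \int[mu]_(x in `[s, t]) f x) ->
  d 0 <= 0 -> 0 < d T ->
  exists t, [/\ 0 < t <= T, P t, 0 < d t, (forall s, 0 <= s <= t -> d s <= d t) &
    exists C h0, [/\ 0 <= C, 0 < h0, h0 < t & forall s, t - h0 <= s -> s < t ->
      \int[mu]_(x in `[s, t]) f x <= C * (t - s)]].
Proof.
move=> aeP T0 cd fint f0 df d0 dT.
pose ft := f \_ `[0, T].
have ft0 x : 0 <= ft x by rewrite /ft patchE; case: ifP.
have ftint : mu.-integrable setT (EFin \o ft).
  by rewrite /ft -restrict_EFin; exact: (integrable_mkcond _ _).1.
have ftintS (A : set R) : measurable A -> mu.-integrable A (EFin \o ft).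
  by move=> mA; apply: integrableS ftint.
have ft_loc : locally_integrable setT ft by exact: integrable_locally.
pose F y := \int[mu]_(x in `[0, y]) ft x.
have aeF : {ae mu, forall x, 0 < x -> derivable F x 1}.
  have := @FTC1 R ft (BLeft 0) (fun y => ftintS _ (measurable_itv _)) ft_loc.
  apply: filterS; first exact: (ae_filter_ringOfSetsType mu).
  move=> x H x0; by have [] := H _; rewrite ?bnd_simp.
have aePF : {ae mu, forall x, P x /\ (0 < x -> derivable F x 1)}.
  apply: filterS2 aeP aeF; first exact: (ae_filter_ringOfSetsType mu).
  by move=> x; split.
(* [A] is a null set containing every point at which [P] fails, or which is positive and at which
   the primitive [F] is not derivable. *)
have [A [mA A0 PA]] := aePF.
(* Absolute continuity: sets of measure below [r] carry less than [d T / 2] of the integral of [ft],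
   so the penalty [J] stays below [d T / 2]. *)
have [r [r0 rint]] := integral_normr_continuous ftint (divr_gt0 dT (ltr0n R 2)).
have A_lty : (mu A < +oo)%E by rewrite A0.
have [U [oU AU muU]] := @lebesgue_regularity_outer R A r mA A_lty r0.
have mU : measurable U by exact: open_measurable.
have muUr : (mu U < r%:E)%E.
  apply: le_lt_trans muU; rewrite -[X in mu X](setDUK AU).
  apply: (@le_trans _ _ (mu A + mu (U `\` A))%E).
    by apply: measureU2 => //; exact: measurableD.
  by rewrite A0 add0e.
have JU := rint U mU muUr.
pose q := ft \_ U.
have q0 x : 0 <= q x by rewrite /q patchE; case: ifP.
have qint : mu.-integrable setT (EFin \o q).
  by rewrite /q -restrict_EFin; apply: (integrable_mkcond _ _).1 => //; exact: ftintS.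
have qintS (B : set R) : measurable B -> mu.-integrable B (EFin \o q).
  by move=> mB; apply: integrableS qint.
pose J y := \int[mu]_(x in `[0, y]) q x.
have JT : J T < d T / 2.
  apply: le_lt_trans JU; rewrite (@eq_Rintegral _ _ _ mu U ft); last first.
    by move=> x _; rewrite ger0_norm.
  rewrite Rintegral_mkcond -/q; apply: ge0_Rintegral_subset => //.
have J_incr s t : 0 <= s -> s <= t -> J t - J s = \int[mu]_(x in `]s, t]) q x.
  by move=> s0 st; apply: Rintegral_itvB; rewrite ?bnd_simp//; exact: qintS.
have J_nd s t : 0 <= s -> s <= t -> J s <= J t.
  by move=> s0 st; rewrite -subr_ge0 J_incr//; apply: Rintegral_ge0 => x _; exact: q0.
have J0 : J 0 = 0 by rewrite /J set_itv1 Rintegral_set1.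
(* The tilt [eta * y] costs [d T / 4] at [T]; after the penalty, [E T] is still positive. Its strict
   growth yields the strict inequality that keeps the maximum point out of [U]. *)
pose eta := d T / (4 * T).
have eta0 : 0 < eta by rewrite divr_gt0// mulr_gt0.
have etaT : eta * T = d T / 4 by rewrite /eta; field; rewrite gt_eqF.
have cJ : {within `[0, T], continuous J}.
  by apply: parameterized_integral_continuous; [exact: ltW|exact: qintS].
have cEta : {within `[0, T], continuous (fun y => eta * y)}.
  by apply: continuous_subspaceT => x; exact: mulrl_continuous.
pose dJ y := d y - J y.
have cdJ : {within `[0, T], continuous dJ}.
  by move=> x; apply: continuousB; [exact: cd|exact: cJ].
pose E y := dJ y - eta * y.
have cE : {within `[0, T], continuous E}.
  by move=> x; apply: continuousB; [exact: cdJ|exact: cEta].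
have [c] := EVT_max (ltW T0) cE.
rewrite in_itv/= => /andP[c_ge0 cT] Emax.
have ET : 0 < E c.
  apply: (@lt_le_trans _ _ (E T)); last by apply: Emax; rewrite in_itv/= lexx ltW.
  by rewrite /E /dJ etaT; lra.
have c0 : 0 < c.
  rewrite lt_neqAle c_ge0 andbT; apply/eqP => c0; move: ET.
  by rewrite -c0 /E /dJ J0 mulr0 !subr0 ltNge d0.
have dmax s : 0 <= s <= c -> d s <= d c.
  move=> /andP[s0 sc].
  have := Emax s; rewrite in_itv/= s0 (le_trans sc cT) => /(_ isT).
  have := J_nd _ _ s0 sc; have : eta * s <= eta * c by rewrite ler_pM2l.
  by rewrite /E /dJ; lra.
have ftf s t : 0 <= s -> t <= T -> \int[mu]_(x in `[s, t]) f x = \int[mu]_(x in `[s, t]) ft x.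
  move=> s0 tT; apply: eq_Rintegral => x; rewrite inE /= in_itv/= => /andP[sx xt].
  by rewrite /ft patchE mem_set//= in_itv/= (le_trans s0 sx) (le_trans xt tT).
(* If [c] lay in the open set [U], then just left of [c] the penalty [J] would grow at least as fast
   as [d], and the tilt would make [E s > E c]. *)
have cU : ~ U c.
  move=> Uc.
  have [r1 /= r10 ballU] := (open_nbhs_nbhs (conj oU Uc) : nbhs c U).
  pose s := Num.max (c / 2) (c - r1 / 2).
  have s0 : 0 < s by rewrite lt_max divr_gt0.
  have sc : s < c by rewrite gt_max; apply/andP; split; lra.
  have sr : c - r1 / 2 <= s by rewrite le_max lexx orbT.
  have fq : \int[mu]_(x in `[s, c]) f x = J c - J s.
    rewrite (J_incr _ _ (ltW s0) (ltW sc)) (ftf _ _ (ltW s0) cT).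
    rewrite Rintegral_itv_obnd_cbnd; last exact: qintS.
    apply: eq_Rintegral => x; rewrite inE /= in_itv/= => /andP[sx xc].
    rewrite /q patchE mem_set//; apply: ballU; rewrite /ball/= ger0_norm; lra.
  have := df _ _ s0 sc cT; rewrite fq.
  have := Emax s; rewrite in_itv/= (ltW s0) (le_trans (ltW sc) cT) => /(_ isT).
  have : eta * s < eta * c by rewrite ltr_pM2l.
  by rewrite /E /dJ; lra.
have [Pc] : P c /\ (0 < c -> derivable F c 1).
  by apply: contrapT => nPc; apply: cU; apply: AU; exact: PA.
move=> /(_ c0) dF.
exists c; split => //.
  by rewrite c0.
  have := J_nd _ _ (lexx 0) c_ge0; have := mulr_gt0 eta0 c0; move: ET.
  by rewrite /E /dJ J0; lra.
have [h1 h10 H] := derivable_left_increment dF ltr01.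
exists (`|derive1 F c| + 1), (Num.min (c / 2) (h1 / 2)); split.
- by rewrite addr_ge0.
- by rewrite lt_min !divr_gt0.
- by rewrite gt_min; apply/orP; left; lra.
move=> s; set h0 := Num.min _ _ => hs sc.
have h0c : h0 <= c / 2 by rewrite ge_min lexx.
have h0h1 : h0 <= h1 / 2 by rewrite ge_min lexx orbT.
have -> : \int[mu]_(x in `[s, c]) f x = F c - F s.
  rewrite ftf//; last by lra.
  rewrite -Rintegral_itv_obnd_cbnd; last exact: ftintS.
  by rewrite Rintegral_itvB// ?bnd_simp; [exact: ftintS|lra..].
have := H (c - s); rewrite subKr => /(_ _)/(le_trans (ler_norm _)) H1.
have {}H1 : F c - F s - (c - s) * derive1 F c <= 1 * (c - s) by apply: H1; lra.
have : (c - s) * derive1 F c <= (c - s) * `|derive1 F c|.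
  by rewrite ler_wpM2l ?ler_norm//; lra.
lra.
Qed.

End maximum_avoiding_null_set.

(** * Weak derivatives *)

Section weak_derivative.
Context {R : realType}.
Notation mu := (@lebesgue_measure R).
Implicit Types (f u : R -> R) (a b c s t x delta e : R).

Let pos x : R := Num.max x 0.

Let continuous_pos c : continuous (fun x => pos (x - c)).
Proof.
move=> x; apply: (@continuous_max _ _ (fun x => x - c) (fun=> 0)).
  by apply: continuousB; [exact: cvg_id|exact: cst_continuous].
exact: cst_continuous.
Qed.

(** Squaring removes the kink of the positive part; the difference quotient is within [|h|] of the
    limit. *)
Let is_derive_pos2 c x : is_derive x 1 (fun x => pos (x - c) ^+ 2) (2 * pos (x - c)).
Proof.
have H : h^-1 *: (pos (h *: 1 + x - c) ^+ 2 - pos (x - c) ^+ 2) @[h --> 0^'] -->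
    2 * pos (x - c).
  apply/cvgrPdist_le => e e0; near=> h.
  have h0 : h != 0 by near: h; exact: nbhs_dnbhs_neq.
  have he : `|h| <= e by near: h; exact: dnbhs0_le.
  apply: le_trans he; rewrite /GRing.scale/= mulr1.
  have -> : 2 * pos (x - c) - h^-1 * (pos (h + x - c) ^+ 2 - pos (x - c) ^+ 2) =
    - (pos (h + x - c) ^+ 2 - pos (x - c) ^+ 2 - 2 * h * pos (x - c)) / h by field.
  rewrite normrM normrN normfV ler_pdivrMr ?normr_gt0// -normrM -expr2.
  rewrite [leRHS]ger0_norm ?sqr_ge0// (_ : h + x - c = h + (x - c)); last by ring.
  move: (x - c) => y; rewrite ler_norml /pos.
  by have [y0|y0] := leP y 0; have [z0|z0] := leP (h + y) 0; apply/andP; split; nra.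
by split; [apply/cvg_ex; eexists; exact: H|exact: cvg_lim H].
Unshelve. all: by end_near. Qed.

(** A piecewise quadratic C^1 ramp, equal to 0 before [c] and to 1 after [c + 2 * delta]. Its
    derivative [tent] is the hat function of height [1 / delta] on that interval, an approximate
    unit mass. *)
Let step delta c x : R :=
  (pos (x - c) ^+ 2 - 2 * pos (x - (c + delta)) ^+ 2 + pos (x - (c + 2 * delta)) ^+ 2)
  / (2 * delta ^+ 2).

Let tent delta c x : R :=
  (pos (x - c) - 2 * pos (x - (c + delta)) + pos (x - (c + 2 * delta))) / delta ^+ 2.

Let is_derive_step delta c x : 0 < delta -> is_derive x 1 (step delta c) (tent delta c x).
Proof.
move=> d0.
have D1 := is_derive_pos2 c x.
have D2 := is_deriveZ 2 (is_derive_pos2 (c + delta) x).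
have D3 := is_derive_pos2 (c + 2 * delta) x.
have D := is_deriveZ ((2 * delta ^+ 2)^-1) (is_deriveD (is_deriveB D1 D2) D3).
have -> : step delta c = (2 * delta ^+ 2)^-1 \*:
  ((fun x => pos (x - c) ^+ 2) - 2 \*: (fun x => pos (x - (c + delta)) ^+ 2) +
   (fun x => pos (x - (c + 2 * delta)) ^+ 2)).
  by apply/funext => y; rewrite /step mulrC.
apply: (is_derive_eq D); rewrite /tent /GRing.scale/=.
by field; rewrite gt_eqF.
Qed.

Let continuous_tent delta c : continuous (tent delta c).
Proof.
move=> x; rewrite /continuous_at /tent; apply: cvgM; last exact: cvg_cst.
apply: cvgD; last exact: continuous_pos.
apply: cvgB; first exact: continuous_pos.
by apply: cvgM; [exact: cvg_cst|exact: continuous_pos].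
Qed.

Let pos_le0 x : x <= 0 -> pos x = 0. Proof. exact: max_r. Qed.
Let pos_ge0 x : 0 <= x -> pos x = x. Proof. exact: max_l. Qed.

Let step_le delta c x : 0 < delta -> x <= c -> step delta c x = 0.
Proof. by move=> d0 xc; rewrite /step !pos_le0; [field; rewrite gt_eqF|lra..]. Qed.

Let step_ge delta c x : 0 < delta -> c + 2 * delta <= x -> step delta c x = 1.
Proof. by move=> d0 xc; rewrite /step !pos_ge0; [field; rewrite gt_eqF|lra..]. Qed.

Let step01 delta c x : 0 < delta -> 0 <= step delta c x <= 1.
Proof.
move=> d0; have [xc|xc] := leP x c; first by rewrite step_le// lexx ler01.
have [cx|cx] := leP (c + 2 * delta) x; first by rewrite step_ge// lexx ler01.
have dd : 0 < 2 * delta ^+ 2 by rewrite mulr_gt0// exprn_gt0.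
rewrite /step ler_pdivlMr// ler_pdivrMr// mul0r mul1r.
rewrite (@pos_ge0 (x - c)) ?(@pos_le0 (x - (c + 2 * delta))); [|lra..].
have [dx|dx] := leP (x - (c + delta)) 0.
  by rewrite pos_le0//; apply/andP; split; nra.
by rewrite pos_ge0 ?(ltW dx)//; apply/andP; split; nra.
Qed.

Let tent_out delta c x : 0 < delta -> x <= c \/ c + 2 * delta <= x -> tent delta c x = 0.
Proof.
move=> d0 [xc|xc]; rewrite /tent.
  by rewrite !pos_le0; [field; rewrite gt_eqF|lra..].
by rewrite !pos_ge0; [field; rewrite gt_eqF|lra..].
Qed.

Let tent_ge0 delta c x : 0 < delta -> 0 <= tent delta c x.
Proof.
move=> d0; rewrite /tent divr_ge0 ?sqr_ge0//.
have [xc|xc] := leP (x - c) 0.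
  by rewrite !pos_le0; lra.
rewrite (@pos_ge0 (x - c)) ?(ltW xc)//.
rewrite /pos; have [] := leP (x - (c + delta)) 0; have [] := leP (x - (c + 2 * delta)) 0; lra.
Qed.

Let integral_tent delta c s t : 0 < delta -> s < t -> s <= c -> c + 2 * delta <= t ->
  \int[mu]_(x in `[s, t]) tent delta c x = 1.
Proof.
move=> d0 st sc ct; rewrite /Rintegral.
have -> : (\int[mu]_(x in `[s, t]) (tent delta c x)%:E =
   (step delta c t)%:E - (step delta c s)%:E)%E.
  apply: derivable_FTC2 => // [x _|]; first exact: is_derive_step.
  exact: continuous_subspaceT.
by rewrite (step_le d0 sc) (step_ge d0 ct) -EFinB/= subr0.
Qed.

Let integral_tent_approx delta c s t u a e : 0 < delta -> s < t -> s <= c ->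
  c + 2 * delta <= t -> {within `[s, t], continuous u} ->
  (forall x, c <= x <= c + 2 * delta -> `|u x - a| <= e) ->
  `|\int[mu]_(x in `[s, t]) (u x * tent delta c x) - a| <= e.
Proof.
move=> d0 st sc ct cu ua.
have it : mu.-integrable `[s, t] (EFin \o tent delta c).
  apply: continuous_compact_integrable; first exact: segment_compact.
  exact: continuous_subspaceT.
have iut (f : R -> R) : {within `[s, t], continuous f} ->
    mu.-integrable `[s, t] (EFin \o (fun x => f x * tent delta c x)).
  move=> cf; rewrite (_ : (fun x => f x * tent delta c x) =
    (fun x => tent delta c x * f x)); last by apply/funext => x; rewrite mulrC.
  by apply: integrable_continuous_mull => //; exact: segment_compact.
have ca : {within `[s, t], continuous (fun=> a : R)} by move=> x; exact: cst_continuous.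
have cua : {within `[s, t], continuous (fun x => u x - a)}.
  by move=> x; apply: continuousB; [exact: cu|exact: ca].
rewrite -[X in _ - X](mulr1 a) -(integral_tent d0 st sc ct) -RintegralZl//.
rewrite -RintegralB//; [|exact: iut|exact: iut].
under eq_Rintegral do rewrite -mulrBl.
apply: (le_trans (le_normr_Rintegral _ _)) => //; first exact: iut.
rewrite -[leRHS]mulr1 -(integral_tent d0 st sc ct) -RintegralZl//.
apply: le_Rintegral => //.
- exact: (integrable_norm (iut _ cua)).
- by apply: (@integrableZl _ _ _ mu _ _ e _ it).
move=> x _; rewrite normrM (ger0_norm (tent_ge0 _ _ d0)).
have [xc|xc] := leP x c; first by rewrite tent_out ?mulr0//; left.
have [cx|cx] := leP (c + 2 * delta) x; first by rewrite tent_out ?mulr0//; right.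
by rewrite ler_wpM2r ?tent_ge0// ua// !ltW.
Qed.

Let Rintegral_supp f s t : 0 < s -> (forall x, x \notin `[s, t] -> f x = 0) ->
  \int[mu]_(x in `]0, +oo[) f x = \int[mu]_(x in `[s, t]) f x.
Proof.
move=> s0 f0; rewrite [LHS]Rintegral_mkcond [RHS]Rintegral_mkcond.
congr Rintegral; apply/funext => x; rewrite !patchE.
case: ifPn => x0; case: ifPn => xst //.
  by rewrite f0//; apply: contra xst => xst; rewrite inE.
move: x0 xst; rewrite notin_setE inE /= !in_itv/= andbT => x0 /andP[sx _].
by exfalso; apply: x0; exact: lt_le_trans sx.
Qed.

Let approx_increment (X1 X2 X3 X4 a b e : R) : `|X1 - a| <= e / 2 ->
  `|X2 - b| <= e / 2 -> `|X3| <= X4 -> X1 - X2 = - X3 -> `|b - a| <= X4 + e.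
Proof.
rewrite !ler_norml => /andP[? ?] /andP[? ?] /andP[? ?] ?.
by apply/andP; split; lra.
Qed.

(** Tested against a C^1 approximation [phi] of the indicator of [[s, t]], the weak derivative
    identity has left side close to [u s - u t], while [|phi| <= 1] bounds its right side by the
    integral of [|f'|]. *)
Lemma W11loc_pos_increment u : W11loc_pos u ->
  exists f, [/\ L1loc_pos f, (forall x, 0 <= f x) &
    forall s t, 0 < s -> s < t -> `|u t - u s| <= \int[mu]_(x in `[s, t]) f x].
Proof.
move=> [cu [f' [_ f'int weak]]]; exists (fun x => `|f' x|); split => //.
  by move=> T T0; exact: (integrable_norm (f'int T T0)).
move=> s t s0 st; apply/ler_addgt0Pr => e e0.
have cuI : {within `[s, t], continuous u}.
  by apply: continuous_subspaceW cu; apply: subset_itv; rewrite bnd_simp// ltW.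
have e20 : 0 < e / 2 by rewrite divr_gt0.
have [_ us ut] := (continuous_within_itvP u st).1 cuI.
have [r1 r10 Hr1] : exists2 r1, 0 < r1 & forall x, s <= x <= s + r1 -> `|u x - u s| <= e / 2.
  have /cvgrPdist_le/(_ _ e20)[r /= r0 H] := us.
  exists (r / 2); first by rewrite divr_gt0.
  move=> x /andP[]; rewrite le_eqVlt => /predU1P[<- _|sx xr].
    by rewrite subrr normr0 ltW.
  by rewrite distrC; apply: H => //; rewrite /= distrC gtr0_norm ?subr_gt0//; lra.
have [r2 r20 Hr2] : exists2 r2, 0 < r2 & forall x, t - r2 <= x <= t -> `|u x - u t| <= e / 2.
  have /cvgrPdist_le/(_ _ e20)[r /= r0 H] := ut.
  exists (r / 2); first by rewrite divr_gt0.
  move=> x /andP[+ ]; rewrite [x <= t]le_eqVlt => + /predU1P[->|xt]; move=> tx.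
    by rewrite subrr normr0 ltW.
  by rewrite distrC; apply: H => //; rewrite /= gtr0_norm ?subr_gt0//; lra.
pose delta := Num.min (Num.min (r1 / 2) (r2 / 2)) ((t - s) / 4).
have d0 : 0 < delta by rewrite !lt_min !divr_gt0// subr_gt0.
have d1 : delta <= r1 / 2 by rewrite !ge_min lexx.
have d2 : delta <= r2 / 2 by rewrite !ge_min lexx orbT.
have d3 : delta <= (t - s) / 4 by rewrite ge_min lexx orbT.
(* The descending ramp ends exactly at [t], so [phi] is supported in [[s, t]]; the bound
   [delta <= (t - s) / 4] keeps the two ramps apart. *)
pose c := t - 2 * delta.
pose phi x := step delta s x - step delta c x.
have dphi x : is_derive x 1 phi (tent delta s x - tent delta c x).
  by apply: is_deriveB; exact: is_derive_step.
have phi' : derive1 phi = (fun x => tent delta s x - tent delta c x).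
  by apply/funext => x; rewrite derive1E; have [] := dphi x.
have phi0 x : x \notin `[s, t] -> phi x = 0.
  rewrite in_itv/= negb_and -!ltNge /phi => /orP[xs|tx].
    by rewrite !step_le ?subr0 /c//; lra.
  by rewrite !step_ge ?subrr /c//; lra.
have phi01 x : `|phi x| <= 1.
  have /andP[? ?] := step01 s x d0; have /andP[? ?] := step01 c x d0.
  rewrite /phi ler_norml; apply/andP; split; lra.
have test : test_function phi.
  split.
  - by move=> x; have [] := dphi x.
  - by rewrite phi' => x; apply: continuousB; exact: continuous_tent.
  - by exists s, t.
have := weak _ test.
rewrite (@Rintegral_supp _ s t)//; last first.
  move=> x; rewrite phi' in_itv/= negb_and -!ltNge => /orP[xs|tx].
    by rewrite !tent_out ?subr0 ?mulr0//; left; rewrite /c; lra.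
  by rewrite !tent_out ?subr0 ?mulr0//; right; rewrite /c; lra.
rewrite (@Rintegral_supp _ s t)//; last first.
  by move=> x xst; rewrite phi0 ?mulr0.
have iut c' : mu.-integrable `[s, t] (EFin \o (fun x => u x * tent delta c' x)).
  rewrite (_ : (fun x => u x * tent delta c' x) =
    (fun x => tent delta c' x * u x)); last by apply/funext => x; rewrite mulrC.
  apply: integrable_continuous_mull => //; first exact: segment_compact.
  apply: continuous_compact_integrable; first exact: segment_compact.
  exact: continuous_subspaceT.
rewrite phi'; under eq_Rintegral do rewrite mulrBr.
rewrite RintegralB// => E.
have A1 : `|\int[mu]_(x in `[s, t]) (u x * tent delta s x) - u s| <= e / 2.
  by apply: integral_tent_approx => //; [lra|move=> x /andP[? ?]; apply: Hr1; lra].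
have A2 : `|\int[mu]_(x in `[s, t]) (u x * tent delta c x) - u t| <= e / 2.
  apply: integral_tent_approx => //; rewrite /c; [lra..|].
  by move=> x /andP[? ?]; apply: Hr2; lra.
have f'st : mu.-integrable `[s, t] (EFin \o f').
  apply: integrableS (f'int t (lt_trans s0 st)) => //.
  by apply: subset_itvr; rewrite bnd_simp ltW.
have if' : mu.-integrable `[s, t] (EFin \o (fun x => f' x * phi x)).
  apply: integrable_continuous_mull => //; first exact: segment_compact.
  apply: derivable_within_continuous => x _; by have [] := dphi x.
have A3 : `|\int[mu]_(x in `[s, t]) (f' x * phi x)| <= \int[mu]_(x in `[s, t]) `|f' x|.
  apply: (le_trans (le_normr_Rintegral _ _)) => //.
  apply: le_Rintegral => //; [exact: (integrable_norm if')|exact: (integrable_norm f'st)|].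
  by move=> x _; rewrite normrM ler_piMr.
exact: (approx_increment A1 A2 A3 E).
Qed.

End weak_derivative.

(** * The fractional kernel *)

Section fractional_kernel.
Context {R : realType} (alpha : R).
Notation mu := (@lebesgue_measure R).
Hypothesis alpha_gt0 : 0 < alpha.
Hypothesis alpha_lt1 : alpha < 1.

Let k : R -> R := g (1 - alpha).
Let G1 : R := Gamma (1 - alpha).

Lemma Gamma_1Balpha_gt0 : 0 < G1.
Proof.
have a0 := alpha_gt0; have a1 := alpha_lt1.
by apply: Gamma_gt0; [lra|lra|rewrite lt_eqF//; lra].
Qed.
Let G1_gt0 := Gamma_1Balpha_gt0.

Lemma fractional_kernelE t : k t = t `^ (- alpha) / G1.
Proof. by rewrite /k /g (_ : 1 - alpha - 1 = - alpha)//; lra. Qed.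
Let kE := fractional_kernelE.

Lemma fractional_kernel_ge0 t : 0 <= k t.
Proof. by rewrite kE divr_ge0 ?powR_ge0// ltW. Qed.

Lemma fractional_kernel_gt0 t : 0 < t -> 0 < k t.
Proof. by move=> t0; rewrite kE divr_gt0 ?powR_gt0. Qed.

Lemma fractional_kernel_nonincreasing s t : 0 < s -> s <= t -> k t <= k s.
Proof.
move=> s0 st; rewrite !kE ler_pM2r ?invr_gt0// !powRN lef_pV2 ?posrE ?powR_gt0//; last first.
  exact: lt_le_trans st.
apply: ge0_ler_powR; rewrite ?nnegrE ?(ltW alpha_gt0) ?(ltW s0)//.
by rewrite (le_trans _ st)// ltW.
Qed.

Let measurable_k : measurable_fun setT k.
Proof.
rewrite (_ : k = fun t => t `^ (- alpha) * G1^-1); last by apply/funext => t; rewrite kE.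
by apply: measurable_funM => //; exact: measurable_powR.
Qed.

Let integral_k_le b : 0 < b ->
  (\int[mu]_(s in `[0%R, b]) (k s)%:E <= (b `^ (1 - alpha) / ((1 - alpha) * G1))%:E)%E.
Proof.
have a0 := alpha_gt0; have a1 := alpha_lt1.
move=> b0; under eq_integral do rewrite kE EFinM muleC.
rewrite ge0_integralZl_EFin//.
- rewrite (_ : b `^ _ / _ = G1^-1 * (b `^ (1 - alpha) / (1 - alpha))); last first.
    by field; rewrite (gt_eqF G1_gt0) andbT gt_eqF//; lra.
  rewrite EFinM; apply: lee_wpmul2l; first by rewrite lee_fin invr_ge0 ltW.
  have := @integral_powR_le R b (1 - alpha) b0.
  rewrite (_ : 1 - alpha - 1 = - alpha); last by lra.
  by apply; lra.
- by move=> *; rewrite lee_fin powR_ge0.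
- by apply/measurable_EFinP; apply: measurable_funTS; exact: measurable_powR.
- by rewrite invr_ge0 ltW.
Qed.

Lemma fractional_kernel_integrable T : mu.-integrable `[0, T] (EFin \o k).
Proof.
have b0 : 0 < Num.max T 1 by rewrite lt_max ltr01 orbT.
apply: (@integrableS _ _ _ mu `[0, Num.max T 1]) => //.
  by apply: subset_itvl; rewrite bnd_simp le_max lexx.
apply/integrableP; split.
  by apply/measurable_EFinP; exact: measurable_funTS.
under eq_integral => s _ do rewrite /= ger0_norm ?fractional_kernel_ge0//.
by apply: le_lt_trans (integral_k_le b0) _; rewrite ltry.
Qed.

Lemma mass_fractional_kernel_le b : 0 < b ->
  mass k b <= b `^ (1 - alpha) / ((1 - alpha) * G1).
Proof.
move=> b0; rewrite /mass /Rintegral -lee_fin fineK ?integral_k_le//.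
by apply: integrable_fin_num => //; exact: fractional_kernel_integrable.
Qed.

Lemma mass_fractional_kernel_small e : 0 < e ->
  exists2 h1, 0 < h1 & forall h, 0 < h < h1 -> mass k h <= e.
Proof.
have a0 := alpha_gt0; have a1 := alpha_lt1.
move=> e0; have a2 : 0 < 1 - alpha by lra.
have c0 : 0 < e * ((1 - alpha) * G1) by rewrite !mulr_gt0.
have /cvgrPdist_le/(_ _ c0)[r /= r0 H] := powR_cvg0 a2.
exists r => // h /andP[h0 hr]; apply: le_trans (mass_fractional_kernel_le h0) _.
rewrite ler_pdivrMr ?mulr_gt0//; apply: le_trans (H h _ h0) => /=.
  by rewrite sub0r normrN ler_norm.
by rewrite sub0r normrN gtr0_norm.
Qed.

End fractional_kernel.

(** * Negative powers: tangent bound, monotonicity and continuity *)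

Section power_function.
Context {R : realType}.
Implicit Types (x y p a b : R).

(** Convexity, scaled to [x = b / a]: [x^(-p) = exp (- p ln x) >= 1 - p ln x >= 1 - p (x - 1)]. *)
Lemma powRN_tangent p a b : 0 < p -> 0 < a -> a <= b ->
  a `^ (- p) - b `^ (- p) <= p * a `^ (- p - 1) * (b - a).
Proof.
move=> p0 a0 ab; have b0 := lt_le_trans a0 ab.
have -> : b `^ (- p) = a `^ (- p) * (b / a) `^ (- p).
  by rewrite -powRM ?divr_ge0 ?(ltW a0) ?(ltW b0)// mulrC divfK// gt_eqF.
have -> : a `^ (- p - 1) = a `^ (- p) / a.
  by rewrite powRB ?powRr1 ?(ltW a0)//; apply/implyP => _; rewrite gt_eqF.
set x := b / a; have x0 : 0 < x by rewrite divr_gt0.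
have H : 1 - p * (x - 1) <= x `^ (- p).
  rewrite /powR gt_eqF//; apply: le_trans (expR_ge1Dx _); rewrite mulNr lerD2l lerN2 ler_pM2l//.
  by have := @le_ln1Dx R (x - 1); rewrite subrKC; apply; lra.
have -> : p * (a `^ (- p) / a) * (b - a) = a `^ (- p) * (p * (x - 1)).
  by rewrite /x; field; rewrite gt_eqF.
have := powR_ge0 a (- p); move: (a `^ (- p)) (x `^ (- p)) (p * (x - 1)) H => A X Y H A0.
nra.
Qed.

Lemma powRN_nonincreasing p a b : 0 < p -> 0 < a -> a <= b -> b `^ (- p) <= a `^ (- p).
Proof.
move=> p0 a0 ab; have b0 := lt_le_trans a0 ab.
rewrite !powRN lef_pV2 ?posrE ?powR_gt0//; apply: ge0_ler_powR => //.
- exact: ltW.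
- by rewrite nnegrE ltW.
- by rewrite nnegrE ltW.
Qed.

Lemma continuous_powR p x : 0 < x -> {for x, continuous (fun y : R => y `^ p)}.
Proof.
move=> x0; apply: differentiable_continuous; apply/derivable1_diffP.
by apply: derivable_powR; rewrite in_itv/= andbT.
Qed.

End power_function.

(** * The barriers *)

Section lower_barrier.
Context {R : realType} (alpha nu gamma u0 : R).
Hypothesis alpha_gt0 : 0 < alpha.
Hypothesis alpha_lt1 : alpha < 1.
Hypothesis nu_gt0 : 0 < nu.
Hypothesis gamma_gt0 : 0 < gamma.
Hypothesis u0_gt0 : 0 < u0.

Let p := alpha / gamma.
Let G1 := Gamma (1 - alpha).
Let G2 := Gamma (1 + alpha).
Let m := mu alpha nu gamma u0.
Let ep := eps alpha nu gamma u0.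
Let vv := v alpha nu gamma u0.

Let p0 : 0 < p. Proof. exact: divr_gt0. Qed.
Let G1_gt0 : 0 < G1. Proof. exact: Gamma_1Balpha_gt0. Qed.
Let G2_gt0 : 0 < G2.
Proof.
have a0 := alpha_gt0; have a1 := alpha_lt1.
by apply: Gamma_gt0; [lra|lra|rewrite gt_eqF//; lra].
Qed.
Let m_gt0 : 0 < m. Proof. by rewrite /m /mu !mulr_gt0 ?powR_gt0. Qed.

Lemma eps_gt0 : 0 < ep.
Proof. by rewrite /ep /eps powR_gt0// divr_gt0// mulr_gt0. Qed.
Let ep_gt0 := eps_gt0.

Let coef_gt0 : 0 < ep `^ p * (u0 / 2).
Proof. by apply: mulr_gt0; [exact: (powR_gt0 p ep_gt0)|exact: divr_gt0]. Qed.

Let ep_alpha : ep `^ alpha = u0 * G2 / (2 * m).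
Proof.
rewrite /ep /eps -powRrM div1r mulVf ?gt_eqF// powRr1//.
by rewrite ltW// divr_gt0// mulr_gt0.
Qed.

Let A x : R := u0 - m * (x `^ alpha / G2).
Let B x : R := ep `^ p * (u0 / 2) * x `^ (- p).

Let A_ep : A ep = u0 / 2.
Proof. by rewrite /A ep_alpha; field; rewrite (gt_eqF m_gt0) (gt_eqF G2_gt0). Qed.

Let B_ep : B ep = u0 / 2.
Proof. by rewrite /B powRN; field; rewrite gt_eqF// powR_gt0. Qed.

(** The two branches meet at the value [u0 / 2], so truncating their arguments at [ep] merges them
    into one formula, from which monotonicity and continuity follow branch by branch. *)
Let vE t : vv t = A (Num.min t ep) + B (Num.max t ep) - u0 / 2.
Proof.
rewrite /vv /v -/ep; case: ifPn => [te|].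
  rewrite min_l// max_r// B_ep addrK /A /g.
  by rewrite (_ : 1 + alpha - 1 = alpha)//; lra.
rewrite -ltNge => /ltW te; rewrite min_r// max_l// A_ep.
by rewrite (addrC (u0 / 2)) addrK.
Qed.

Let A_noninc x y : 0 <= x -> x <= y -> A y <= A x.
Proof.
move=> x0 xy; rewrite /A lerD2l lerN2 ler_pM2l// ler_pM2r ?invr_gt0//.
by apply: ge0_ler_powR; rewrite ?nnegrE ?(ltW alpha_gt0)//; exact: le_trans xy.
Qed.

Let B_noninc x y : 0 < x -> x <= y -> B y <= B x.
Proof.
move=> x0 xy; rewrite /B ler_pM2l; first exact: powRN_nonincreasing.
exact: coef_gt0.
Qed.

Lemma v_nonincreasing x y : 0 <= x -> x <= y -> vv y <= vv x.
Proof.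
move=> x0 xy; rewrite !vE lerD2r lerD//.
  by apply: A_noninc; [rewrite le_min x0 ltW|rewrite le_min ge_min xy/= ge_min lexx orbT].
apply: B_noninc; first by rewrite lt_max ep_gt0 orbT.
by rewrite ge_max le_max xy/= le_max lexx orbT.
Qed.

Lemma v0E : vv 0 = u0.
Proof.
by rewrite vE min_l ?max_r ?(ltW ep_gt0)// B_ep addrK /A powR0 ?gt_eqF// mul0r mulr0 subr0.
Qed.

Lemma v_gt0 t : 0 <= t -> 0 < vv t.
Proof.
move=> t0; rewrite /vv /v -/ep; case: ifPn => [te|].
  have := v_nonincreasing t0 te; rewrite [in vv t]/vv /v -/ep te.
  apply: lt_le_trans; rewrite vE min_l ?max_r// A_ep B_ep; have := u0_gt0; lra.
rewrite -ltNge => te.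
by apply: mulr_gt0; [exact: coef_gt0|apply: powR_gt0; exact: lt_trans te].
Qed.

Lemma v_continuous T : 0 < T -> {within `[0, T], continuous vv}.
Proof.
move=> T0.
have vF : vv = (fun t => A (Num.min t ep) + B (Num.max t ep) - u0 / 2).
  by apply/funext => t; exact: vE.
have cv t : 0 < t -> {for t, continuous vv}.
  move=> t0; rewrite vF.
  have cmin : {for t, continuous (fun x : R => Num.min x ep)}.
    by apply: (@continuous_min _ _ id (fun=> ep)); [exact: cvg_id|exact: cst_continuous].
  have cmax : {for t, continuous (fun x : R => Num.max x ep)}.
    by apply: (@continuous_max _ _ id (fun=> ep)); [exact: cvg_id|exact: cst_continuous].
  rewrite /continuous_at; apply: cvgB; last exact: cvg_cst.
  apply: cvgD.
    apply: cvgB; first exact: cvg_cst.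
    apply: cvgM; first exact: cvg_cst.
    apply: cvgM; last exact: cvg_cst.
    apply: (@continuous_comp _ _ _ (fun x : R => Num.min x ep) (fun x => x `^ alpha)) => //.
    by apply: continuous_powR; rewrite lt_min t0.
  apply: cvgM; first exact: cvg_cst.
  apply: (@continuous_comp _ _ _ (fun x : R => Num.max x ep) (fun x => x `^ (- p))) => //.
  by apply: continuous_powR; rewrite lt_max t0.
apply/(continuous_within_itvP _ T0); split.
- by move=> t; rewrite in_itv/= => /andP[t0 _]; exact: cv.
(* At 0 continuity cannot come from derivability of the power, since [alpha < 1]; the limit is taken
   on the first branch. *)
- have : A t @[t --> 0^'+] --> vv 0.
    rewrite v0E -[X in _ --> X]subr0 -[X in _ - X](mulr0 m) -[X in m * X](mul0r G2^-1).
    apply: cvgB; first exact: cvg_cst.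
    apply: cvgM; first exact: cvg_cst.
    by apply: cvgM; [exact: powR_cvg0|exact: cvg_cst].
  apply: cvg_trans; apply: near_eq_cvg; near=> t.
  have te : t <= ep by near: t; exact: nbhs_right_le.
  by rewrite vE min_l// max_r// B_ep addrK.
- by apply: cvg_at_left_filter; exact: cv.
Unshelve. all: by end_near. Qed.

Let gamma_m : m / (G1 * G2) = nu * u0 `^ gamma.
Proof. by rewrite /m /mu -/G1 -/G2; field; rewrite (gt_eqF G1_gt0) (gt_eqF G2_gt0). Qed.

(** Up to [ep] the powers of [t] cancel and the right side is the constant [nu * u0^gamma]. Beyond
    [ep], [u0 - v >= u0 / 2], and [(alpha / gamma) * gamma = alpha] gives both sides the factor
    [t^(-alpha)]. *)
Lemma v_subsolution t : 0 < t -> nu * vv t `^ gamma <= g (1 - alpha) t * (u0 - vv t).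
Proof.
move=> t0; rewrite fractional_kernelE -/G1.
have [te|te] := leP t ep.
  have -> : t `^ (- alpha) / G1 * (u0 - vv t) = nu * u0 `^ gamma.
    rewrite -gamma_m vE min_l// max_r// B_ep addrK /A powRN; field.
    by rewrite (gt_eqF G1_gt0) (gt_eqF G2_gt0) gt_eqF// powR_gt0.
  have vtu0 : vv t <= u0 by rewrite -[leRHS]v0E; apply: v_nonincreasing => //; exact: ltW.
  rewrite ler_pM2l//; apply: ge0_ler_powR => //; first exact: ltW.
    by rewrite nnegrE ltW// v_gt0// ltW.
  by rewrite nnegrE ltW.
have vt : vv t = ep `^ p * (u0 / 2) * t `^ (- p) by rewrite /vv /v -/ep leNgt te.
have vt2 : vv t <= u0 / 2.
  have := v_nonincreasing (ltW ep_gt0) (ltW te); rewrite [X in _ <= X]vE min_l// max_r//.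
  by rewrite A_ep B_ep; lra.
have pg : p * gamma = alpha by rewrite /p divfK// gt_eqF.
have -> : vv t `^ gamma = ep `^ alpha * (u0 / 2) `^ gamma * t `^ (- alpha).
  rewrite vt !powRM ?mulr_ge0 ?powR_ge0 ?divr_ge0 ?(ltW u0_gt0)//.
  by rewrite -!powRrM mulNr pg.
have u02 : (u0 / 2) `^ gamma <= u0 `^ gamma.
  apply: ge0_ler_powR; rewrite ?nnegrE ?divr_ge0 ?(ltW u0_gt0) ?(ltW gamma_gt0)//.
  by rewrite ler_pdivrMr// ler_pMr//; lra.
apply: (@le_trans _ _ (t `^ (- alpha) / G1 * (u0 / 2))); last first.
  by rewrite ler_wpM2l ?divr_ge0 ?powR_ge0 ?(ltW G1_gt0)//; have := u0_gt0; lra.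
(* The value of [ep^alpha] matches the coefficients up to the last factor, which is at most 1. *)
have -> : nu * (ep `^ alpha * (u0 / 2) `^ gamma * t `^ (- alpha)) =
  t `^ (- alpha) / G1 * (u0 / 2) * ((u0 / 2) `^ gamma / u0 `^ gamma).
  rewrite ep_alpha /m /mu -/G1 -/G2; field.
  by rewrite (gt_eqF G1_gt0) (gt_eqF G2_gt0) (gt_eqF nu_gt0) gt_eqF// powR_gt0.
rewrite ler_piMr//.
  by rewrite mulr_ge0 ?divr_ge0 ?powR_ge0 ?(ltW G1_gt0) ?(ltW u0_gt0).
by rewrite ler_pdivrMr ?powR_gt0// mul1r.
Qed.

Lemma v_decay_bound : exists2 c, 0 < c & forall t, 0 <= t ->
  c / (1 + t `^ (alpha / gamma)) <= vv t.
Proof.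
have c1 : 0 < u0 / 2 by rewrite divr_gt0.
have c2 := coef_gt0.
exists (Num.min (u0 / 2) (ep `^ p * (u0 / 2))); first by rewrite lt_min c1.
move=> t t0; rewrite -/p; have tp := powR_ge0 t p.
have tp1 : 0 < 1 + t `^ p by lra.
rewrite ler_pdivrMr//.
have [te|te] := leP t ep.
  have v2 : u0 / 2 <= vv t.
    have := v_nonincreasing t0 te; rewrite [X in X <= _]vE min_l// max_r// A_ep B_ep; lra.
  apply: (@le_trans _ _ (u0 / 2)); first by rewrite ge_min lexx.
  by apply: le_trans v2 _; rewrite ler_peMr ?(ltW (v_gt0 t0))//; lra.
have t_gt0 : 0 < t by exact: lt_trans te.
have -> : vv t = ep `^ p * (u0 / 2) * t `^ (- p) by rewrite /vv /v -/ep leNgt te.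
apply: (@le_trans _ _ (ep `^ p * (u0 / 2))); first by rewrite ge_min lexx orbT.
rewrite -[leRHS]mulrA ler_peMr ?(ltW c2)// powRN mulrDr mulVf ?gt_eqF ?powR_gt0// lerDr.
by rewrite mulr_ge0 ?invr_ge0 ?powR_ge0.
Qed.

End lower_barrier.


Section upper_barrier.
Context {R : realType} (alpha nu gamma u0 t0 : R).
Hypothesis alpha_gt0 : 0 < alpha.
Hypothesis alpha_lt1 : alpha < 1.
Hypothesis nu_gt0 : 0 < nu.
Hypothesis gamma_gt0 : 0 < gamma.
Hypothesis u0_gt0 : 0 < u0.
Hypothesis t0_gt0 : 0 < t0.

Let p := alpha / gamma.
Let G1 := Gamma (1 - alpha).
Let ww := w alpha gamma u0 t0.

Let p0 : 0 < p. Proof. exact: divr_gt0. Qed.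
Let G1_gt0 : 0 < G1. Proof. exact: Gamma_1Balpha_gt0. Qed.

Let coef_gt0 : 0 < u0 * t0 `^ p.
Proof. by apply: mulr_gt0 => //; exact: powR_gt0. Qed.

Let wE t : ww t = u0 * t0 `^ p * (Num.max t t0) `^ (- p).
Proof.
rewrite /ww /w; case: ifPn => [tt0|]; last by rewrite -ltNge => /ltW tt0; rewrite max_l.
by rewrite max_r// powRN mulfK// gt_eqF// powR_gt0.
Qed.

Let max_gt0 t : 0 < Num.max t t0. Proof. by rewrite lt_max t0_gt0 orbT. Qed.

Lemma w_le_t0 t : t <= t0 -> ww t = u0.
Proof. by move=> tt0; rewrite /ww /w tt0. Qed.

Lemma w_gt0 t : 0 < ww t.
Proof. by rewrite wE; apply: mulr_gt0 => //; apply: powR_gt0; exact: max_gt0. Qed.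

Lemma w_nonincreasing x y : x <= y -> ww y <= ww x.
Proof.
move=> xy; rewrite !wE ler_pM2l//; apply: powRN_nonincreasing => //.
by rewrite ge_max le_max xy/= le_max lexx orbT.
Qed.

Lemma w_continuous : continuous ww.
Proof.
move=> t.
have wF : ww = (fun t => u0 * t0 `^ p * (Num.max t t0) `^ (- p)) by apply/funext => x; exact: wE.
rewrite wF /continuous_at; apply: cvgM; first exact: cvg_cst.
apply: (@continuous_comp _ _ _ (fun x : R => Num.max x t0) (fun x => x `^ (- p))).
  by apply: (@continuous_max _ _ id (fun=> t0)); [exact: cvg_id|exact: cst_continuous].
by apply: continuous_powR; exact: max_gt0.
Qed.

(** Minus the derivative at [y] of the power branch of [w]; as it decreases in [y], it is a
    Lipschitz constant for that branch on [[y, +oo[]. *)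
Definition w_slope y : R := p * (u0 * t0 `^ p) * y `^ (- p - 1).

Lemma w_slope_ge0 y : 0 <= w_slope y.
Proof. by rewrite mulr_ge0 ?powR_ge0// mulr_ge0// ltW. Qed.

Lemma w_decrement y s t : 0 < y -> y <= Num.max s t0 -> s <= t ->
  ww s - ww t <= w_slope y * (t - s).
Proof.
move=> y0 ys st; rewrite !wE -mulrBr.
set a := Num.max s t0; set b := Num.max t t0.
have ab : a <= b by rewrite /a /b ge_max le_max st/= le_max lexx orbT.
have bats : b - a <= t - s.
  by rewrite /a /b; have [] := leP s t0; have [] := leP t t0; lra.
have a0 : 0 < a := max_gt0 s.
rewrite /w_slope.
have -> : p * (u0 * t0 `^ p) * y `^ (- p - 1) * (t - s) =
  u0 * t0 `^ p * (p * (y `^ (- p - 1) * (t - s))) by ring.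
rewrite ler_pM2l//; apply: le_trans (powRN_tangent p0 a0 ab) _.
rewrite -mulrA ler_pM2l//.
apply: ler_pM => //; [exact: powR_ge0|by rewrite subr_ge0|].
rewrite (_ : - p - 1 = - (p + 1)); last by ring.
by apply: powRN_nonincreasing => //; exact: ltr_wpDr.
Qed.

(** The left side is the rate from [conv_increment_le] with [L] the slope at [t / 2]. Its two terms
    are matched separately with the two summands defining [t0^alpha], each times
    [u0 * t^(-alpha)]. *)
Lemma w_supersolution t : t0 `^ alpha = t0_pow_alpha alpha nu gamma u0 -> t0 < t ->
  w_slope (t / 2) * mass (g (1 - alpha)) (t / 2) +
    g (1 - alpha) (t / 2) * (u0 - ww (t / 2)) <= nu * ww t `^ gamma.
Proof.
move=> t0E tt0; have t_gt0 : 0 < t by exact: lt_trans tt0.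
have a0 := alpha_gt0; have a1 := alpha_lt1.
have t2 : 0 < t / 2 by rewrite divr_gt0.
have pg : p * gamma = alpha by rewrite /p divfK// gt_eqF.
have ta : 0 < t `^ (- alpha) by exact: powR_gt0.
pose G3 := Gamma (2 - alpha).
have G3_gt0 : 0 < G3 by apply: Gamma_gt0; [lra|lra|rewrite gt_eqF//; lra].
(* The mass bound carries [(1 - alpha) * G1] in its denominator; this direction allows replacing it
   by the smaller [Gamma (2 - alpha)]. *)
have G3_le : G3 <= (1 - alpha) * G1.
  rewrite /G3 (_ : 2 - alpha = 1 - alpha + 1); last by lra.
  by apply: GammaD1_le; lra.
have -> : nu * ww t `^ gamma = u0 * t `^ (- alpha) *
    (g (1 - alpha) (1 / 2) + p * (2 `^ (alpha + p) / G3)).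
  rewrite wE max_l ?ltW// powRM ?(ltW coef_gt0) ?powR_ge0// powRM ?powR_ge0 ?(ltW u0_gt0)//.
  rewrite -!powRrM mulNr pg t0E /t0_pow_alpha -/p -/G3.
  have -> : u0 `^ (1 - gamma) = u0 / u0 `^ gamma.
    by rewrite powRB ?powRr1 ?(ltW u0_gt0)//; apply/implyP => _; rewrite gt_eqF.
  by field; rewrite (gt_eqF nu_gt0) (gt_eqF G3_gt0) gt_eqF// powR_gt0.
rewrite [leRHS]mulrDr [leLHS]addrC; apply: lerD.
  have -> : g (1 - alpha) (t / 2) = t `^ (- alpha) * g (1 - alpha) (1 / 2).
    by rewrite !fractional_kernelE mulrA -powRM ?(ltW t_gt0) ?divr_ge0// mulrA mulr1.
  rewrite mulrC mulrA [X in _ <= X * _]mulrC; apply: ler_wpM2r.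
    exact: fractional_kernel_ge0.
  by rewrite mulrC ler_wpM2l ?(ltW ta)// gerBl ltW// w_gt0.
have H1 : mass (g (1 - alpha)) (t / 2) <= (t / 2) `^ (1 - alpha) / G3.
  apply: le_trans (mass_fractional_kernel_le alpha_gt0 alpha_lt1 t2) _.
  rewrite ler_wpM2l ?powR_ge0// lef_pV2 ?posrE//.
  by apply: mulr_gt0 => //; lra.
apply: (@le_trans _ _ (w_slope (t / 2) * ((t / 2) `^ (1 - alpha) / G3))).
  by rewrite ler_wpM2l// w_slope_ge0.
(* The surplus factor [(t0 / t)^p] is at most 1 because [t > t0]. *)
have -> : w_slope (t / 2) * ((t / 2) `^ (1 - alpha) / G3) =
    u0 * t `^ (- alpha) * (p * (2 `^ (alpha + p) / G3)) * (t0 / t) `^ p.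
  have t2n : t / 2 != 0 by rewrite gt_eqF.
  have E1 : (t / 2) `^ (- p - 1) * (t / 2) `^ (1 - alpha) =
      2 `^ (alpha + p) * t `^ (- alpha) / t `^ p.
    rewrite -powRD; last by rewrite t2n implybT.
    rewrite (_ : - p - 1 + (1 - alpha) = - (alpha + p)); last by ring.
    have -> : (t / 2) `^ (- (alpha + p)) = t `^ (- (alpha + p)) * 2 `^ (alpha + p).
      rewrite powRM ?(ltW t_gt0)// [X in _ * X = _]powRN; congr (_ * _).
      by rewrite -[2^-1]powR_inv1// -powRrM mulN1r powRN invrK.
    have -> : t `^ (- (alpha + p)) = t `^ (- alpha) * t `^ (- p).
      by rewrite -powRD ?(gt_eqF t_gt0) ?implybT// opprD.
    by rewrite (powRN t p); ring.
  have -> : (t0 / t) `^ p = t0 `^ p / t `^ p.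
    rewrite powRM ?invr_ge0 ?(ltW t0_gt0) ?(ltW t_gt0)//.
    by rewrite -[in (t^-1) `^ _]powR_inv1 ?(ltW t_gt0)// -powRrM mulN1r powRN.
  rewrite /w_slope -!mulrA [(t / 2) `^ (- p - 1) * _]mulrA E1.
  by field; rewrite (gt_eqF G3_gt0) (gt_eqF gamma_gt0) gt_eqF// powR_gt0.
rewrite ler_piMr//.
  rewrite mulr_ge0//; first by rewrite mulr_ge0// ltW.
  by rewrite mulr_ge0 ?(ltW p0)// divr_ge0 ?powR_ge0// ltW.
apply: (@le_trans _ _ (1 `^ p)); last by rewrite powR1.
apply: ge0_ler_powR => //; first exact: ltW.
- by rewrite nnegrE divr_ge0 ?(ltW t0_gt0) ?(ltW t_gt0).
- by rewrite nnegrE.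
- by rewrite ler_pdivrMr// mul1r ltW.
Qed.

Lemma w_decay_bound : exists2 c, 0 < c & forall t, 0 <= t ->
  ww t <= c / (1 + t `^ (alpha / gamma)).
Proof.
have tp0 : 0 < t0 `^ p by exact: powR_gt0.
exists (u0 * (1 + t0 `^ p)); first by rewrite mulr_gt0// addr_gt0.
move=> t t_ge0; rewrite -/p; have tp := powR_ge0 t p.
rewrite ler_pdivlMr; last by lra.
rewrite wE; have [tt0|tt0] := leP t t0.
  rewrite powRN mulfK ?gt_eqF// ler_pM2l// lerD2l.
  by apply: ge0_ler_powR; rewrite ?nnegrE ?(ltW p0) ?(ltW t0_gt0).
have t_gt0 : 0 < t by exact: lt_trans tt0.
have tp_gt0 : 0 < t `^ p by exact: powR_gt0.
have t0tp : t0 `^ p <= t `^ p.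
  by apply: ge0_ler_powR; rewrite ?nnegrE ?(ltW p0) ?(ltW t0_gt0) ?(ltW tt0).
have -> : u0 * t0 `^ p * t `^ (- p) * (1 + t `^ p) = u0 * (t0 `^ p / t `^ p + t0 `^ p).
  by rewrite powRN; field; rewrite gt_eqF.
by rewrite ler_pM2l// lerD2r ler_pdivrMr// mul1r.
Qed.

End upper_barrier.

(** * Comparison *)

Section comparison.
Context {R : realType} (alpha nu gamma u0 : R) (u : R -> R).
Hypothesis alpha_gt0 : 0 < alpha.
Hypothesis alpha_lt1 : alpha < 1.
Hypothesis nu_gt0 : 0 < nu.
Hypothesis gamma_gt0 : 0 < gamma.
Hypothesis u0_gt0 : 0 < u0.
Hypothesis u_W11 : W11loc_pos u.
Hypothesis u_ge0 : forall t : R, 0 <= t -> 0 <= u t.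
Hypothesis u_eq : {ae @lebesgue_measure R, forall t : R, 0 < t ->
  RLderivable alpha (fun s => u s - u0) t /\
  RLderive alpha (fun s => u s - u0) t + nu * u t `^ gamma = 0}.
Hypothesis u_init : u 0 = u0.
Notation mu := (@lebesgue_measure R).
Local Notation conv := (@Defs.conv R).
Let k : R -> R := g (1 - alpha).

Let k_ge0 : forall s, 0 <= k s.
Proof. by move=> s; exact: fractional_kernel_ge0. Qed.
Let k_gt0 : forall s, 0 < s -> 0 < k s.
Proof. by move=> s; exact: fractional_kernel_gt0. Qed.
Let k_decr : forall s t, 0 < s -> s <= t -> k t <= k s.
Proof. by move=> s t; exact: fractional_kernel_nonincreasing. Qed.
Let k_int : forall T, mu.-integrable `[0, T] (EFin \o k).
Proof. by move=> T; exact: fractional_kernel_integrable. Qed.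
Let k_small : forall e, 0 < e -> exists2 h1, 0 < h1 & forall h, 0 < h < h1 -> mass k h <= e.
Proof. by move=> e; exact: mass_fractional_kernel_small. Qed.

Let u_cont t : {within `[0, t], continuous u}.
Proof.
have [cu _] := u_W11.
by apply: continuous_subspaceW cu; apply: subset_itvl; rewrite bnd_simp.
Qed.

Let cst_cont (c t : R) : {within `[0, t], continuous (fun=> c : R)}.
Proof. by move=> x; exact: cst_continuous. Qed.

Let conv_oppE t : conv k (fun s => u0 - u s) t = - conv k (fun s => u s - u0) t.
Proof. by rewrite !convB// opprB. Qed.

Lemma le_lower_barrier t : 0 <= t -> v alpha nu gamma u0 t <= u t.
Proof.
move=> t_ge0; rewrite leNgt; apply/negP => ut_lt.
have T0 : 0 < t.
  rewrite lt_neqAle t_ge0 andbT; apply/eqP => t0; move: ut_lt.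
  by rewrite -t0 u_init v0E// ltxx.
have [f [fL1 f0 fu]] := W11loc_pos_increment u_W11.
pose d s := v alpha nu gamma u0 s - u s.
have cd : {within `[0, t], continuous d}.
  by move=> x; apply: continuousB; [exact: v_continuous|exact: u_cont].
have df a b : 0 < a -> a < b -> b <= t -> d b - d a <= \int[mu]_(x in `[a, b]) f x.
  move=> a0 ab _; have := fu _ _ a0 ab; rewrite ler_norml => /andP[+ _].
  have := v_nonincreasing alpha_gt0 alpha_lt1 nu_gt0 gamma_gt0 u0_gt0 (ltW a0) (ltW ab).
  by rewrite /d; lra.
have d0 : d 0 <= 0 by rewrite /d u_init v0E// subrr.
have dt : 0 < d t by rewrite /d subr_gt0.
have [s [/andP[s0 st] Ps ds dmax [C [h0 [C0 h00 h0s fC]]]]] :=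
  exists_ae_running_max u_eq T0 cd (fL1 t T0) f0 df d0 dt.
have {Ps} [Du Eu] := Ps s0.
pose U x := u0 - u x.
have cU : {within `[0, s], continuous U}.
  by move=> x; apply: continuousB; [exact: cst_cont|exact: u_cont].
have vs_le : v alpha nu gamma u0 s <= u0.
  have := v_nonincreasing alpha_gt0 alpha_lt1 nu_gt0 gamma_gt0 u0_gt0 (lexx 0) (ltW s0).
  by rewrite v0E.
have Us : 0 <= U s by move: ds; rewrite /d /U; lra.
(* [U] is [d] plus the nondecreasing function [u0 - v], so it inherits the maximum at the right end
   [s]. *)
have Umax x : 0 <= x <= s -> U x <= U s.
  move=> xs; have := dmax x xs; move: xs => /andP[x0 xs].
  have := v_nonincreasing alpha_gt0 alpha_lt1 nu_gt0 gamma_gt0 u0_gt0 x0 xs.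
  by rewrite /d /U; lra.
have UC x : s - h0 <= x -> x < s -> U s - U x <= C * (s - x).
  move=> hx xs; apply: le_trans (fC x hx xs).
  have x0 : 0 < x by lra.
  by have := fu _ _ x0 xs; rewrite ler_norml /U => /andP[+ _]; lra.
have kU : k s * U s <= nu * u s `^ gamma.
  have cUE : conv k U = - conv k (fun s => u s - u0).
    by apply/funext => x; exact: conv_oppE.
  have <- : derive1 (conv k U) s = nu * u s `^ gamma.
    have := Eu; rewrite cUE /RLderive !derive1E deriveN//.
    by move=> /eqP; rewrite addr_eq0 => /eqP ->; rewrite opprK.
  apply: le_derive1_left_increment.
    by rewrite cUE; exact: derivableN.
  by move=> e e0; apply: (conv_increment_at_max _ _ _ _ C0 h00 h0s _ cU Us Umax UC).
have sub := v_subsolution alpha_gt0 alpha_lt1 nu_gt0 gamma_gt0 u0_gt0 s0.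
have uv : u s < v alpha nu gamma u0 s by rewrite -subr_gt0.
have ug : nu * u s `^ gamma <= nu * v alpha nu gamma u0 s `^ gamma.
  rewrite ler_pM2l//; apply: ge0_ler_powR; rewrite ?nnegrE ?(ltW gamma_gt0) ?(ltW uv)//.
    by rewrite u_ge0// ltW.
  by rewrite (le_trans _ (ltW uv))// u_ge0// ltW.
have : k s * (u0 - v alpha nu gamma u0 s) < k s * U s.
  by rewrite ltr_pM2l ?k_gt0// /U; lra.
by rewrite ltNge; apply/negP; apply/negPn; exact: le_trans kU (le_trans ug sub).
Qed.

Lemma le_upper_barrier t0 t : 0 < t0 -> t0 `^ alpha = t0_pow_alpha alpha nu gamma u0 ->
  0 <= t -> u t <= w alpha gamma u0 t0 t.
Proof.
move=> t0_gt0 t0E t_ge0; rewrite leNgt; apply/negP => ut_lt.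
set ww := w alpha gamma u0 t0 in ut_lt *.
have T0 : 0 < t.
  rewrite lt_neqAle t_ge0 andbT; apply/eqP => tE; move: ut_lt.
  by rewrite -tE u_init /ww w_le_t0 ?ltxx// ltW.
have cw : continuous ww by exact: w_continuous.
have w_ni x y : x <= y -> ww y <= ww x.
  by move=> xy; exact: w_nonincreasing.
have w0 x : 0 < ww x by exact: w_gt0.
have w_le x : ww x <= u0.
  have [xt0|/ltW xt0] := leP x t0; first by rewrite /ww w_le_t0.
  by rewrite -[leRHS](w_le_t0 alpha gamma u0 (lexx t0)); exact: w_ni.
have cww (x : R) : {within `[0, x], continuous ww} by exact: continuous_subspaceT.
have [f [fL1 f0 fu]] := W11loc_pos_increment u_W11.
pose d s := u s - ww s.
have cd (x : R) : {within `[0, x], continuous d}.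
  by move=> y; apply: continuousB; [exact: u_cont|exact: cww].
pose L0 := w_slope alpha gamma u0 t0 t0.
have L0_ge0 : 0 <= L0 by exact: w_slope_ge0.
have wL0 x y : x <= y -> ww x - ww y <= L0 * (y - x).
  by move=> xy; apply: w_decrement => //; rewrite le_max lexx orbT.
(* Since [w] decreases, [d = u - w] can grow faster than [u]; the Lipschitz constant [L0] of [w] is
   added to compensate. *)
pose f1 x := f x + L0.
have cstint (a b : R) : mu.-integrable `[a, b] (EFin \o (fun=> L0)).
  apply: continuous_compact_integrable; first exact: segment_compact.
  by move=> x; exact: cst_continuous.
have fint : mu.-integrable `[0, t] (EFin \o f).
  exact: fL1.
have f1int : mu.-integrable `[0, t] (EFin \o f1).
  by apply: (@integrableD _ _ _ mu _ _ _ _ fint (cstint 0 t)).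
have f1_ge0 x : 0 <= f1 x by rewrite addr_ge0.
have f1E a b : 0 < a -> a < b -> b <= t ->
    \int[mu]_(x in `[a, b]) f1 x = \int[mu]_(x in `[a, b]) f x + L0 * (b - a).
  move=> a0 ab bt; rewrite RintegralD//; last first.
    by apply: integrableS fint => //; apply: subset_itv; rewrite bnd_simp// ltW.
  rewrite Rintegral_cst//= lebesgue_measure_itv/= lte_fin ab.
  by rewrite -EFinB.
have df a b : 0 < a -> a < b -> b <= t -> d b - d a <= \int[mu]_(x in `[a, b]) f1 x.
  move=> a0 ab bt; rewrite f1E//; have := fu _ _ a0 ab; rewrite ler_norml => /andP[_ H].
  by apply: le_trans (lerD H (wL0 _ _ (ltW ab))); rewrite /d; lra.
have d0 : d 0 <= 0 by rewrite /d u_init /ww w_le_t0 ?subrr// ltW.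
have dt : 0 < d t by rewrite /d subr_gt0.
have [s [/andP[s0 st] Ps ds dmax [C [h0 [C0 h00 h0s fC]]]]] :=
  exists_ae_running_max u_eq T0 (cd t) f1int f1_ge0 df d0 dt.
have {Ps} [Du Eu] := Ps s0.
have dC x : s - h0 <= x -> x < s -> d s - d x <= C * (s - x).
  move=> hx xs; apply: le_trans (fC x hx xs); apply: df => //.
  by apply: lt_le_trans hx; rewrite subr_gt0.
pose W x := u0 - ww x.
have cW : continuous W.
  by move=> x; apply: continuousB; [exact: cst_continuous|exact: cw].
have conv_dE x : conv k d x = conv k W x + conv k (fun s => u s - u0) x.
  by rewrite !convB//; ring.
have key : k s * d s <= nu * ww s `^ gamma - nu * u s `^ gamma.
  (* Derivability of [conv k W] is not at hand, so any rate [rho] bounding its left increments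
     serves instead of its derivative. *)
  have rho_bound rho : (exists2 h2, 0 < h2 & forall h, 0 < h < h2 ->
      conv k W s - conv k W (s - h) <= h * rho) ->
      k s * d s <= rho - nu * u s `^ gamma.
    move=> [h2 h20 H2].
    rewrite -lerBlDl (_ : - (nu * u s `^ gamma) = derive1 (conv k (fun s => u s - u0)) s); last first.
      by apply/esym/eqP; rewrite -addr_eq0; apply/eqP.
    apply: le_derive1_left_increment => // e e0.
    have [h1 h10 H1] := conv_increment_at_max k_ge0 k_decr k_int s0 C0 h00 h0s
      k_small (cd s) (ltW ds) dmax dC e0.
    exists (Num.min h1 h2); first by rewrite lt_min h10.
    move=> h; rewrite lt_min => /and3P[h_gt0 hh1 hh2].
    have := H1 h; rewrite h_gt0 hh1 => /(_ isT).
    have := H2 h; rewrite h_gt0 hh2 => /(_ isT).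
    by rewrite !conv_dE; lra.
  have W0 x : x <= t0 -> W x = 0 by move=> xt0; rewrite /W /ww w_le_t0// subrr.
  have [st0|t0s] := leP s t0.
    apply: (@le_trans _ _ (0 - nu * u s `^ gamma)); last first.
      by rewrite lerD2r mulr_ge0 ?powR_ge0 ?(ltW nu_gt0).
    apply: rho_bound; exists 1 => // h /andP[h_gt0 _].
    have convW0 x : x <= t0 -> conv k W x = 0.
      move=> xt0; rewrite /Defs.conv (@eq_Rintegral _ _ _ mu _ (fun=> 0)).
        by rewrite Rintegral_cst// mul0r.
      by move=> y; rewrite inE/= in_itv/= => /andP[_ yx]; rewrite W0 ?mulr0//; exact: le_trans xt0.
    by rewrite !convW0 ?subrr ?mulr0//; lra.
  rewrite lerBrDr.
  apply: le_trans (w_supersolution alpha_gt0 alpha_lt1 nu_gt0 gamma_gt0 u0_gt0 t0_gt0 t0E t0s).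
  have s20 : 0 < s / 2 by rewrite divr_gt0.
  (* The increments of [W] reach back to [x - h], slightly below [s / 2]. The slope is therefore
     taken at some [y < s / 2] with [h < s / 2 - y], and then [y] tends to [s / 2] from the left. *)
  have cslope : w_slope alpha gamma u0 t0 y * mass k (s / 2) + k (s / 2) * W (s / 2)
      @[y --> (s / 2)^'-] -->
      w_slope alpha gamma u0 t0 (s / 2) * mass k (s / 2) + k (s / 2) * W (s / 2).
    apply: cvg_at_left_filter; apply: cvgD; last exact: cvg_cst.
    apply: cvgM; last exact: cvg_cst.
    by apply: cvgM; [exact: cvg_cst|exact: continuous_powR].
  apply: (cvgr_to_ge cslope); near=> y.
  have y0 : 0 < y by near: y; exact: nbhs_left_gt.
  have ys : y < s / 2 by near: y; exact: nbhs_left_lt.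
  rewrite -lerBrDr; apply: rho_bound.
  exists (s / 2 - y); first by rewrite subr_gt0.
  move=> h /andP[h_gt0 hy].
  apply: conv_increment_le => //.
  - by lra.
  - by move=> a b ab; rewrite /W lerD2l lerN2; exact: w_ni.
  - by move=> x x0; apply: W0; lra.
  - exact: w_slope_ge0.
  - move=> x sx; rewrite /W opprB addrC addrA subrK.
    rewrite [leRHS](_ : _ = w_slope alpha gamma u0 t0 y * (x - (x - h))); last by rewrite subKr.
    apply: w_decrement => //; last by lra.
    by rewrite le_max; apply/orP; left; lra.
have ug : nu * ww s `^ gamma <= nu * u s `^ gamma.
  rewrite ler_pM2l//; apply: ge0_ler_powR; rewrite ?nnegrE ?(ltW gamma_gt0) ?(ltW (w0 s))//.
    by rewrite u_ge0// ltW.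
  by rewrite ltW// -subr_gt0.
by have := mulr_gt0 (k_gt0 s0) ds; lra.
Unshelve. all: by end_near. Qed.

End comparison.

Theorem theorem7p1 (R : realType) (alpha nu gamma u0 : R) (u : R -> R)
    (alpha_gt0 : 0 < alpha) (alpha_lt1 : alpha < 1)
    (nu_gt0 : 0 < nu) (gamma_gt0 : 0 < gamma) (u0_gt0 : 0 < u0)
    (u_W11 : W11loc_pos u)
    (u_ge0 : forall t : R, 0 <= t -> 0 <= u t)
    (u_eq : {ae @lebesgue_measure R, forall t : R, 0 < t ->
       RLderivable alpha (fun s => u s - u0) t /\
       RLderive alpha (fun s => u s - u0) t + nu * u t `^ gamma = 0})
    (u_init : u 0 = u0)
    (t0 : R) (t0_gt0 : 0 < t0)
    (t0_def : t0 `^ alpha = t0_pow_alpha alpha nu gamma u0) :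
  (forall t : R, 0 <= t ->
     v alpha nu gamma u0 t <= u t /\ u t <= w alpha gamma u0 t0 t) /\
  (exists c1 c2 : R, [/\ 0 < c1, 0 < c2 &
     forall t : R, 0 <= t ->
       c1 / (1 + t `^ (alpha / gamma)) <= u t /\
       u t <= c2 / (1 + t `^ (alpha / gamma))]).
Proof.
have lower t (t_ge0 : 0 <= t) := le_lower_barrier alpha_gt0 alpha_lt1 nu_gt0
  gamma_gt0 u0_gt0 u_W11 u_ge0 u_eq u_init t_ge0.
have upper t (t_ge0 : 0 <= t) := le_upper_barrier alpha_gt0 alpha_lt1 nu_gt0
  gamma_gt0 u0_gt0 u_W11 u_ge0 u_eq u_init t0_gt0 t0_def t_ge0.
split=> [t t_ge0|]; first by split; [exact: lower|exact: upper].
have [c1 c1_gt0 vc1] := v_decay_bound alpha_gt0 alpha_lt1 nu_gt0 gamma_gt0 u0_gt0.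
have [c2 c2_gt0 wc2] := w_decay_bound alpha_gt0 gamma_gt0 u0_gt0 t0_gt0.
exists c1, c2; split=> // t t_ge0; split.
  exact: le_trans (vc1 t t_ge0) (lower t t_ge0).
exact: le_trans (upper t t_ge0) (wc2 t t_ge0).
Qed.
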